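(* Let $X$ be a Banach space and let $\mathcal{U}$ be a non-principal ultrafilter on $\mathbb{N}$. If $X$ is almost transitive, then $\mathcal{M}(X)$ is transitive. If $X$ is uniformly convex-transitive, then $\mathcal{M}(X)$ and $X^{\mathcal{U}}$ are uniformly convex-transitive. In particular, $(L^{\infty})^{\mathcal{U}}$ is uniformly convex-transitive.
   Context: All Banach spaces are real. For $i\in\mathbb{N}$, $i\ge1$, $L^i(X)$ is the Bochner space of $X$-valued $i$-integrable functions on $[0,1]$ with Lebesgue measure $m$; $L^\infty=L^\infty([0,1],m)$. Let $Y=\bigoplus_{i=1}^{\infty}L^{i}(X)$ (direct sum in the $\ell^\infty$-sense) and $N_{\mathcal{U}}=\{(y_i)\in Y:\ \lim_{i,\mathcal{U}}\|y_i\|=0\}$; then $\mathcal{M}(X)=Y/N_{\mathcal{U}}$ with the quotient norm. $X^{\mathcal{U}}$ is the ultrapower $\ell^\infty(X)/\{(x_i):\ \lim_{i,\mathcal{U}}\|x_i\|=0\}$. For a Banach space $X$, $\mathbf{S}_X$ is its unit sphere and $\mathcal{G}_X$ is the group of isometric (linear, surjective) automorphisms of $X$; $\mathcal{G}_X(x)=\{T(x):T\in\mathcal{G}_X\}$. $X$ is transitive (resp. almost transitive) if $\mathcal{G}_X(x)=\mathbf{S}_X$ (resp. $\overline{\mathcal{G}_X(x)}=\mathbf{S}_X$) for all $x\in\mathbf{S}_X$. For $x\in\mathbf{S}_X$ and $n\in\mathbb{N}$ put $C_n(x)=\{\sum_{i=1}^{n}a_iT_i(x):\ T_1,\dots,T_n\in\mathcal{G}_X,\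 a_1,\dots,a_n\in[0,1],\ \sum_{i=1}^n a_i=1\}$. $X$ is uniformly convex-transitive if for each $\varepsilon>0$ there is $n\in\mathbb{N}$ such that $\mathrm{dist}(y,C_n(x))\leq\varepsilon$ for all $x,y\in\mathbf{S}_X$. *)

(* Defs.v *)
From HB Require Import structures.
From mathcomp Require Import all_boot all_order all_algebra.
From mathcomp Require Import generic_quotient ring_quotient.
From mathcomp Require Import all_classical all_reals all_analysis.
From mathcomp Require Import measurable_realfun ess_sup_inf.

Set Implicit Arguments.
Unset Strict Implicit.
Unset Printing Implicit Defensive.

Import Order.TTheory GRing.Theory Num.Def Num.Theory.
Import numFieldNormedType.Exports.

Local Open Scope classical_set_scope.
Local Open Scope ring_scope.

Section transitivity.
Context {R : realType}.
Implicit Type X : normedModType R.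

Definition unit_sphere X : set X := [set x | `|x| = 1].

Definition isometric_automorphism X : set {linear X -> X} :=
  [set T | (forall x, `|T x| = `|x|) /\ (forall y, exists x, T x = y)].

Definition isometry_orbit X (x : X) : set X :=
  [set T x | T in @isometric_automorphism X].

Definition transitive_space X : Prop :=
  forall x : X, unit_sphere x -> isometry_orbit x = @unit_sphere X.

Definition almost_transitive_space X : Prop :=
  forall x : X, unit_sphere x -> closure (isometry_orbit x) = @unit_sphere X.

Definition orbit_convex_combinations X (n : nat) (x : X) : set X :=
  [set y | exists (T : 'I_n -> {linear X -> X}) (a : 'I_n -> R),
    [/\ forall i, isometric_automorphism (T i),
        forall i, 0 <= a i <= 1,
        \sum_(i < n) a i = 1
      & y = \sum_(i < n) a i *: T i x]].

(* [orbit_convex_combinations 0 x] is empty, and [edist_inf set0 y] is [+oo],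
   so a witness [n] is automatically positive on a nonzero space. *)
Definition uniformly_convex_transitive X : Prop :=
  forall eps : R, 0 < eps -> exists n : nat,
    forall x y : X, unit_sphere x -> unit_sphere y ->
      (edist_inf (orbit_convex_combinations n x) y <= eps%:E)%E.

End transitivity.

(* [submodClosed], being stated over semirings, does not inherit from
   [zmodClosed], which [Quotient.quot] requires. *)
Section zmod_of_submod.
Context {R : pzRingType} {V : lmodType R} (N : submodClosed V).

Let zmod_closedN : zmod_closed N := GRing.submod_closedB (submodClosedP N).

Definition zmod_of_submod : zmodClosed V :=
  HB.pack (GRing.SubmodClosed.sort N) (GRing.isZmodClosed.Build V _ zmod_closedN).

Lemma submodN v : (- v \in N) = (v \in N).
Proof. exact: (@rpredN V zmod_of_submod). Qed.

End zmod_of_submod.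

(* [q] is a seminorm on [V] with null space [N]; it turns V / N into a normed
   space.  It is used both to identify functions equal almost everywhere and to
   form the quotient of a normed space by a closed subspace. *)
Record seminorm (R : realType) (V : lmodType R) (N : submodClosed V) := Seminorm {
  seminorm_fun :> V -> R ;
  seminormD : forall u v, seminorm_fun (u + v) <= seminorm_fun u + seminorm_fun v ;
  seminormZ : forall a v, seminorm_fun (a *: v) = `|a| * seminorm_fun v ;
  seminorm_eq0 : forall v, seminorm_fun v = 0 <-> v \in N }.

Definition seminorm_quot (R : realType) (V : lmodType R) (N : submodClosed V)
  (q : seminorm N) : Type := (Quotient.quot (zmod_of_submod N)).

Section seminorm_quot.
Local Open Scope quotient_scope.
Context {R : realType} {V : lmodType R} {N : submodClosed V} (q : seminorm N).
Local Notation Q := (seminorm_quot q).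

HB.instance Definition _ := Choice.copy Q (Quotient.quot (zmod_of_submod N)).
HB.instance Definition _ := GRing.Zmodule.copy Q (Quotient.quot (zmod_of_submod N)).

Definition quot_class (v : V) : Q := \pi_((Quotient.quot (zmod_of_submod N))) v.

Lemma quot_classK (x : Q) : quot_class (repr (x : (Quotient.quot (zmod_of_submod N)))) = x.
Proof. exact: reprK. Qed.

Lemma quot_classP (u v : V) : quot_class u = quot_class v <-> u - v \in N.
Proof.
have E : (u - v \in N) = (quot_class u == quot_class v).
  exact: (@Quotient.idealrBE V (zmod_of_submod N)).
by rewrite E; split => /eqP.
Qed.

Lemma quot_classD u v : quot_class (u + v) = quot_class u + quot_class v.
Proof. exact: (@Quotient.pi_add V (zmod_of_submod N)). Qed.

Definition quot_scale (a : R) (x : Q) : Q := quot_class (a *: repr (x : (Quotient.quot (zmod_of_submod N)))).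

Lemma quot_scaleE a v : quot_scale a (quot_class v) = quot_class (a *: v).
Proof.
apply/quot_classP; rewrite -scalerBr rpredZ//; apply/quot_classP.
exact: quot_classK.
Qed.

Let scaleA a b x : quot_scale a (quot_scale b x) = quot_scale (a * b) x.
Proof. by rewrite -(quot_classK x) !quot_scaleE scalerA. Qed.

Let scale1 : left_id 1 quot_scale.
Proof. by move=> x; rewrite -(quot_classK x) quot_scaleE scale1r. Qed.

Let scaleDr : right_distributive quot_scale +%R.
Proof.
move=> a x y; rewrite -(quot_classK x) -(quot_classK y).
by rewrite -quot_classD !quot_scaleE scalerDr quot_classD.
Qed.

Let scaleDl x : {morph quot_scale^~ x : a b / a + b}.
Proof.
by move=> a b; rewrite -(quot_classK x) !quot_scaleE scalerDl quot_classD.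
Qed.

HB.instance Definition _ :=
  GRing.Zmodule_isLmodule.Build R Q scaleA scale1 scaleDr scaleDl.

Definition quot_norm (x : Q) : R := q (repr (x : (Quotient.quot (zmod_of_submod N)))).

Lemma quot_normE v : quot_norm (quot_class v) = q v.
Proof.
have le_mod u w : u - w \in N -> q u <= q w.
  move=> /seminorm_eq0 uw; have := seminormD q (u - w) w.
  by rewrite subrK uw add0r.
have uN : repr (quot_class v : (Quotient.quot (zmod_of_submod N))) - v \in N.
  by apply/quot_classP; exact: quot_classK.
by apply/eqP; rewrite eq_le !le_mod// -opprB submodN.
Qed.

Let normD x y : quot_norm (x + y) <= quot_norm x + quot_norm y.
Proof.
rewrite -(quot_classK x) -(quot_classK y) -quot_classD !quot_normE.
exact: seminormD.
Qed.

Let normZ (a : R) x : quot_norm (a *: x) = `|a| * quot_norm x.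
Proof.
rewrite -(quot_classK x) [_ *: _]quot_scaleE !quot_normE.
exact: seminormZ.
Qed.

Let norm0 x : quot_norm x = 0 -> x = 0.
Proof.
rewrite -(quot_classK x) quot_normE => /seminorm_eq0 vN.
have -> : (0 : Q) = quot_class 0.
  by apply: (addrI (quot_class 0)); rewrite -quot_classD !addr0.
by apply/quot_classP; rewrite subr0.
Qed.

HB.instance Definition _ := Lmodule_isNormed.Build R Q normD normZ norm0.

Lemma norm_quot_class v : `|quot_class v : Q| = q v.
Proof. exact: quot_normE. Qed.

End seminorm_quot.

Section quotient_by_closed_subspace.
Context {R : realType} (E : normedModType R) (N : submodClosed E).
Hypothesis clN : closed [set` N].

Definition quotient_norm (y : E) : R := inf [set `|y + n| | n in [set` N]].

Let dists (y : E) : set R := [set `|y + n| | n in [set` N]].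

Let dists_has_inf y : has_inf (dists y).
Proof.
split; first by exists `|y + 0|, 0 => //=; rewrite rpred0.
by exists 0 => _ [n _ <-].
Qed.

Let quotient_norm_le y n : n \in N -> quotient_norm y <= `|y + n|.
Proof.
move=> nN; apply: ge_inf; first by have [] := dists_has_inf y.
by exists n.
Qed.

Let le_quotient_norm y c :
  (forall n, n \in N -> c <= `|y + n|) -> c <= quotient_norm y.
Proof.
move=> h; apply: lb_le_inf; first by have [] := dists_has_inf y.
by move=> _ [n nN <-]; exact: h.
Qed.

Let quotient_norm_ge0 y : 0 <= quotient_norm y.
Proof. exact: le_quotient_norm. Qed.

Let quotient_normD u v :
  quotient_norm (u + v) <= quotient_norm u + quotient_norm v.
Proof.
rewrite -lerBlDr; apply: le_quotient_norm => n nN.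
rewrite lerBlDr -lerBlDl; apply: le_quotient_norm => m mN.
rewrite lerBlDl (le_trans _ (ler_normD _ _))// addrACA.
by apply: quotient_norm_le; rewrite rpredD.
Qed.

Let quotient_normZ_le (a : R) v :
  quotient_norm (a *: v) <= `|a| * quotient_norm v.
Proof.
have [->|a0] := eqVneq a 0.
  rewrite normr0 mul0r scale0r (le_trans (quotient_norm_le _ (rpred0 N)))//.
  by rewrite addr0 normr0.
rewrite -ler_pdivrMl ?normr_gt0//; apply: le_quotient_norm => n nN.
rewrite ler_pdivrMl ?normr_gt0// -normrZ scalerDr.
by apply: quotient_norm_le; rewrite rpredZ.
Qed.

Let quotient_normZ (a : R) v : quotient_norm (a *: v) = `|a| * quotient_norm v.
Proof.
apply/eqP; rewrite eq_le quotient_normZ_le/=.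
have [->|a0] := eqVneq a 0; first by rewrite normr0 mul0r.
rewrite -ler_pdivlMl ?normr_gt0// -normfV.
by have := quotient_normZ_le a^-1 (a *: v); rewrite scalerA mulVf// scale1r.
Qed.

Let quotient_norm_eq0 v : quotient_norm v = 0 <-> v \in N.
Proof.
split=> [v0|vN].
  suff: [set` N] v by [].
  apply: clN => B /nbhs_ballP[e /= e0 eB].
  have [_ [n nN <-]] := inf_adherent e0 (dists_has_inf v).
  rewrite -/(quotient_norm v) v0 add0r => vn.
  exists (- n); split; first by rewrite /= submodN.
  by apply: eB; rewrite -ball_normE /ball_ /= opprK.
apply/eqP; rewrite eq_le quotient_norm_ge0 andbT.
by rewrite (le_trans (quotient_norm_le v (_ : - v \in N))) ?submodN// subrr normr0.
Qed.

Definition quotient_seminorm : seminorm N :=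
  Seminorm quotient_normD quotient_normZ quotient_norm_eq0.

Definition normed_quotient : Type := seminorm_quot quotient_seminorm.

HB.instance Definition _ := NormedModule.on normed_quotient.

End quotient_by_closed_subspace.

Section linfty_sum.
Context {R : realType} (E : nat -> normedModType R).

Record linfty_sum : Type := LinftySum {
  linfty_coord :> forall i, E i ;
  linfty_bounded : has_ubound (range (fun i => `|linfty_coord i|)) }.

Lemma linfty_sumP (x y : linfty_sum) : (forall i, x i = y i) -> x = y.
Proof.
case: x y => [x bx] [y by_] /= xy.
have xyE : x = y by exact: functional_extensionality_dep.
by subst y; congr LinftySum; exact: Prop_irrelevance.
Qed.

HB.instance Definition _ := gen_eqMixin linfty_sum.
HB.instance Definition _ := gen_choiceMixin linfty_sum.

Lemma linfty_boundP (x : forall i, E i) :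
  has_ubound (range (fun i => `|x i|)) <-> exists M, forall i, `|x i| <= M.
Proof.
split=> -[M hM]; exists M; first by move=> i; apply: hM; exists i.
by move=> _ [i _ <-].
Qed.

Let zero_bounded : has_ubound (range (fun i => `|0 : E i|)).
Proof. by apply/linfty_boundP; exists 0 => i; rewrite normr0. Qed.

Let opp_bounded (x : linfty_sum) : has_ubound (range (fun i => `|- x i|)).
Proof.
have /linfty_boundP[M hM] := linfty_bounded x.
by apply/linfty_boundP; exists M => i; rewrite normrN.
Qed.

Let add_bounded (x y : linfty_sum) : has_ubound (range (fun i => `|x i + y i|)).
Proof.
have /linfty_boundP[M hM] := linfty_bounded x.
have /linfty_boundP[M' hM'] := linfty_bounded y.
apply/linfty_boundP; exists (M + M') => i.
by rewrite (le_trans (ler_normD _ _))// lerD ?hM ?hM'.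
Qed.

Let scale_bounded (a : R) (x : linfty_sum) :
  has_ubound (range (fun i => `|a *: x i|)).
Proof.
have /linfty_boundP[M hM] := linfty_bounded x.
by apply/linfty_boundP; exists (`|a| * M) => i; rewrite normrZ ler_wpM2l// hM.
Qed.

Definition linfty_zero : linfty_sum := LinftySum zero_bounded.
Definition linfty_opp x : linfty_sum := LinftySum (opp_bounded x).
Definition linfty_add x y : linfty_sum := LinftySum (add_bounded x y).
Definition linfty_scale a x : linfty_sum := LinftySum (scale_bounded a x).

Let addA : associative linfty_add.
Proof. by move=> x y z; apply: linfty_sumP => i /=; rewrite addrA. Qed.
Let addC : commutative linfty_add.
Proof. by move=> x y; apply: linfty_sumP => i /=; rewrite addrC. Qed.
Let add0 : left_id linfty_zero linfty_add.
Proof. by move=> x; apply: linfty_sumP => i /=; rewrite add0r. Qed.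
Let addN : left_inverse linfty_zero linfty_opp linfty_add.
Proof. by move=> x; apply: linfty_sumP => i /=; rewrite addNr. Qed.

HB.instance Definition _ :=
  GRing.isZmodule.Build linfty_sum addA addC add0 addN.

Let scaleA a b x : linfty_scale a (linfty_scale b x) = linfty_scale (a * b) x.
Proof. by apply: linfty_sumP => i /=; rewrite scalerA. Qed.
Let scale1 : left_id 1 linfty_scale.
Proof. by move=> x; apply: linfty_sumP => i /=; rewrite scale1r. Qed.
Let scaleDr : right_distributive linfty_scale +%R.
Proof. by move=> a x y; apply: linfty_sumP => i /=; rewrite scalerDr. Qed.
Let scaleDl x : {morph linfty_scale^~ x : a b / a + b}.
Proof. by move=> a b; apply: linfty_sumP => i /=; rewrite scalerDl. Qed.

HB.instance Definition _ :=
  GRing.Zmodule_isLmodule.Build R linfty_sum scaleA scale1 scaleDr scaleDl.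

Definition linfty_norm (x : linfty_sum) : R := sup (range (fun i => `|x i|)).

Let coord_le_norm (x : linfty_sum) i : `|x i| <= linfty_norm x.
Proof. by apply: ub_le_sup; [exact: linfty_bounded|exists i]. Qed.

Let norm_le (x : linfty_sum) M : (forall i, `|x i| <= M) -> linfty_norm x <= M.
Proof.
by move=> h; apply: ge_sup => [|_ [i _ <-]//]; exists `|x 0%N|, 0%N.
Qed.

Let normD x y : linfty_norm (x + y) <= linfty_norm x + linfty_norm y.
Proof. by apply: norm_le => i; rewrite (le_trans (ler_normD _ _))// lerD ?coord_le_norm. Qed.

Let normZ_le (a : R) x : linfty_norm (a *: x) <= `|a| * linfty_norm x.
Proof. by apply: norm_le => i; rewrite normrZ ler_wpM2l ?coord_le_norm. Qed.

Let normZ (a : R) x : linfty_norm (a *: x) = `|a| * linfty_norm x.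
Proof.
apply/eqP; rewrite eq_le normZ_le/=.
have [->|a0] := eqVneq a 0.
  by rewrite normr0 mul0r (le_trans _ (coord_le_norm _ 0%N)).
rewrite -ler_pdivlMl ?normr_gt0// -normfV.
by rewrite (le_trans _ (normZ_le _ _))// scalerA mulVf// scale1r.
Qed.

Let norm0 x : linfty_norm x = 0 -> x = 0.
Proof.
move=> x0; apply: linfty_sumP => i /=; apply/eqP; rewrite -normr_le0 -x0.
exact: coord_le_norm.
Qed.

HB.instance Definition _ :=
  Lmodule_isNormed.Build R linfty_sum normD normZ norm0.

Lemma norm_linfty_sumE (x : linfty_sum) : `|x| = sup (range (fun i => `|x i|)).
Proof. by []. Qed.

Lemma linfty_coord_le_norm (x : linfty_sum) i : `|x i| <= `|x|.
Proof. exact: coord_le_norm. Qed.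

End linfty_sum.

Section ultraproduct.
Context {R : realType} (U : set_system nat) {UU : UltraFilter U}.
Variable E : nat -> normedModType R.

Definition ultranull : {pred linfty_sum E} :=
  mem [set y : linfty_sum E | `|y i| @[i --> U] --> (0 : R)].

Lemma ultranullP (y : linfty_sum E) :
  y \in ultranull <-> `|y i| @[i --> U] --> (0 : R).
Proof. by rewrite inE. Qed.

Let ultranull_submod_closed : submod_closed ultranull.
Proof.
split.
  apply/ultranullP; rewrite (_ : (fun i => _) = cst 0); first exact: cvg_cst.
  by apply/funext => i /=; rewrite normr0.
move=> a u v /ultranullP u0 /ultranullP v0; apply/ultranullP.
apply: (@squeeze_cvgr _ _ _ _ (cst 0) (fun i => `|a| * `|u i| + `|v i|)).
- apply: nearW => i; rewrite normr_ge0/= -normrZ.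
  exact: (ler_normD (a *: u i) (v i)).
- exact: cvg_cst.
- rewrite -[X in _ --> X](_ : `|a| * 0 + 0 = 0); last by rewrite mulr0 addr0.
  by apply: cvgD => //; apply: cvgMr.
Qed.

HB.instance Definition _ :=
  GRing.isSubmodClosed.Build R (linfty_sum E) ultranull ultranull_submod_closed.

Lemma ultranull_closed : closed [set` ultranull].
Proof.
move=> y cly; apply/ultranullP/cvgrPdist_lt => e e0.
have e20 : 0 < e / 2 by rewrite divr_gt0.
have [n [/= nN]] := cly _ (nbhsx_ballx y _ e20).
rewrite -ball_normE /ball_ /= => yn.
move/ultranullP/cvgrPdist_lt : nN => /(_ _ e20).
apply: filterS => i; rewrite !sub0r !normrN !normr_id => ni.
rewrite [ltRHS]splitr -[y i](subrK (n i)) (le_lt_trans (ler_normD _ _))// ltrD//.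
exact: le_lt_trans (linfty_coord_le_norm (y - n) i) yn.
Qed.

Definition ultraproduct : Type := normed_quotient ultranull_closed.

HB.instance Definition _ := NormedModule.on ultraproduct.

End ultraproduct.

Arguments ultraproduct {R} U {UU} E.

Definition ultrapower (R : realType) (U : set_system nat) {UU : UltraFilter U}
    (X : normedModType R) : normedModType R :=
  ultraproduct U (fun=> X).

Arguments ultrapower {R} U {UU} X.

Section Lnorm_extra.
Context d {T : measurableType d} {R : realType}.
Variable mu : {measure set T -> \bar R}.
Variables (p : \bar R) (p1 : (1 <= p)%E).
Implicit Types g h : T -> R.
Local Open Scope ereal_scope.

Lemma le_Lnorm g h : measurable_fun setT g -> measurable_fun setT h ->
  (forall t, `|g t| <= `|h t|)%R -> 'N[mu]_p[EFin \o g] <= 'N[mu]_p[EFin \o h].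
Proof.
move=> mg mh gh; rewrite unlock; case: p p1 => [r /= r1|_|//].
  have r0 : (0 <= r)%R by rewrite (le_trans ler01).
  have mpow (k : T -> R) : measurable_fun setT k ->
      measurable_fun setT (fun t => (`|k t| `^ r)%R%:E).
    move=> mk; apply/measurable_EFinP.
    apply: (measurableT_comp (measurable_powR r)).
    exact: measurableT_comp.
  apply: gt0_ler_poweR; rewrite ?invr_ge0// ?in_itv/= ?leey ?andbT.
  - by apply: integral_ge0 => t _; rewrite lee_fin powR_ge0.
  - by apply: integral_ge0 => t _; rewrite lee_fin powR_ge0.
  - apply: ge0_le_integral => //.
    + exact: mpow.
    + exact: mpow.
    + by move=> t _; rewrite lee_fin ge0_ler_powR// nnegrE.
case: ifPn => // _; apply: le_ess_sup; apply: nearW => t /=.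
by rewrite lee_fin.
Qed.

Lemma ae0_Lnorm g : measurable_fun setT g ->
  (\forall t \ae mu, g t = 0%R) -> 'N[mu]_p[EFin \o g] = 0.
Proof.
move=> mg g0; rewrite unlock; case: p p1 => [r /= r1|_|//].
  have r0 : (0 < r)%R by rewrite (lt_le_trans ltr01).
  rewrite (ae_eq_integral (cst 0)) ?integral0 ?poweR0r ?invr_neq0 ?gt_eqF//.
  - apply/measurable_EFinP; apply: (measurableT_comp (measurable_powR r)).
    exact: measurableT_comp.
  - by apply: filterS g0 => t gt0 _ /=; rewrite gt0 normr0 powR0// gt_eqF.
case: ifPn => // mu0; apply: abs_ess_sup_eq0 => //.
by apply: filterS g0 => t gt0 _ /=; rewrite gt0.
Qed.

End Lnorm_extra.

Section Bochner_functions.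
Context d {T : measurableType d} {R : realType}.
Variable mu : {measure set T -> \bar R}.
Variables (p : \bar R) (p1 : (1 <= p)%E) (X : normedModType R).
Implicit Types f g : T -> X.

Definition vsimple f : Prop :=
  finite_set (range f) /\ forall x, measurable (f @^-1` [set x]).

(* The limit is required at every point rather than almost everywhere because
   [lebesgue_measure] lives on the Borel sigma-algebra, which is not complete.
   An almost everywhere limit of simple functions agrees almost everywhere with
   an everywhere one, so the classes in [Bochner_space] are the usual ones. *)
Definition strongly_measurable f : Prop :=
  exists s : nat -> T -> X,
    (forall n, vsimple (s n)) /\ forall t, s n t @[n --> \oo] --> f t.

Lemma vsimple_preimage f (A : set X) : vsimple f -> measurable (f @^-1` A).
Proof.
move=> [finf mf].
rewrite (_ : f @^-1` A = \bigcup_(x in range f `&` A) f @^-1` [set x]).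
  apply: fin_bigcup_measurable => [|x _]; last exact: mf.
  exact: finite_setIl.
apply/seteqP; split => [t At|t [x [_ Ax] /= ->]//].
by exists (f t) => //; split => //; exists t.
Qed.

Lemma vsimple_lin (a : R) f g : vsimple f -> vsimple g -> vsimple (a *: f + g).
Proof.
move=> sf sg; have [finf mf] := sf; split.
  by apply: (finite_image11 (fun x y => a *: x + y)) => //; case: sg.
move=> z.
rewrite (_ : _ @^-1` _ = \bigcup_(x in range f)
    (f @^-1` [set x] `&` g @^-1` [set z - a *: x])).
  apply: fin_bigcup_measurable => // x _; apply: measurableI => //.
  exact: vsimple_preimage.
apply/seteqP; split=> t /=.
  move=> <-; exists (f t); first by exists t.
  by split => //=; rewrite -[(_ + g) t]/(a *: f t + g t) addrAC subrr add0r.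
by move=> [x _ [/= fx gx]]; rewrite -[(_ + g) t]/(a *: f t + g t) fx gx addrC subrK.
Qed.

Lemma strongly_measurable_norm f : strongly_measurable f ->
  measurable_fun setT (fun t => `|f t|).
Proof.
move=> [s [ss sf]].
apply: (@measurable_fun_cvg _ _ _ _ (fun n t => `|s n t|)) => [n|t _].
  move=> _ B mB; rewrite setTI.
  rewrite (_ : _ @^-1` _ = s n @^-1` (normr @^-1` B))//.
  exact: vsimple_preimage.
exact: cvg_norm.
Qed.

Lemma strongly_measurable_lin (a : R) f g :
  strongly_measurable f -> strongly_measurable g -> strongly_measurable (a *: f + g).
Proof.
move=> [s [ss sf]] [s' [ss' sg]]; exists (fun n => a *: s n + s' n).
split=> [n|t]; first exact: vsimple_lin.
by apply: cvgD => //; exact: cvgZr.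
Qed.

Definition Bochner_Lnorm f : \bar R := Lnorm mu p (EFin \o (fun t => `|f t|)).

Definition Bochner_pred of (1 <= p)%E : {pred T -> X} :=
  mem [set f | strongly_measurable f /\ (Bochner_Lnorm f < +oo)%E].

Lemma Bochner_LnormD f g : strongly_measurable f -> strongly_measurable g ->
  (Bochner_Lnorm (f + g)%R <= Bochner_Lnorm f + Bochner_Lnorm g)%E.
Proof.
move=> mf mg.
have mnf := strongly_measurable_norm mf; have mng := strongly_measurable_norm mg.
apply: le_trans (eminkowski _ mnf mng p1); apply: le_Lnorm => //.
- by apply: strongly_measurable_norm; rewrite -[f]scale1r; exact: strongly_measurable_lin.
- exact: measurable_funD.
- by move=> t; rewrite normr_id ger0_norm ?addr_ge0// ler_normD.
Qed.

Lemma Bochner_LnormZ (a : R) f : strongly_measurable f ->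
  (Bochner_Lnorm f < +oo)%E ->
  (Bochner_Lnorm (a *: f)%R = `|a|%:E * Bochner_Lnorm f)%E.
Proof.
move=> mf foo.
have fL : (fun t => `|f t|) \in Lfun mu p.
  apply/andP; rewrite !inE; split => //.
  exact: strongly_measurable_norm.
have := LnormZ (Lfun_Sub p1 fL) `|a|; rewrite normr_id => <-.
by apply: eq_Lnorm => t /=; rewrite fctE normrZ.
Qed.

Lemma Bochner_submod_closed : submod_closed (Bochner_pred p1).
Proof.
have m0 : strongly_measurable 0.
  exists (fun=> 0); split => [_|t]; last exact: cvg_cst.
  split=> [|x].
    by apply: (@sub_finite_set _ _ [set 0]) => // _ [t _ <-].
  by have -> : (0 : T -> X) = cst 0 by []; rewrite preimage_cst; case: ifP.
split.
  rewrite inE; split => //; rewrite /Bochner_Lnorm.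
  rewrite (@eq_Lnorm _ _ _ _ _ _ (cst 0%E)); last by move=> t /=; rewrite normr0.
  by rewrite Lnorm0// gt_eqF// (lt_le_trans _ p1).
move=> a f g; rewrite !inE => -[mf foo] [mg goo].
split; first exact: strongly_measurable_lin.
have maf : strongly_measurable (a *: f).
  by rewrite -[_ *: _]addr0; exact: strongly_measurable_lin.
rewrite (le_lt_trans (Bochner_LnormD maf mg))// lte_add_pinfty//.
by rewrite Bochner_LnormZ// lte_mul_pinfty.
Qed.

HB.instance Definition _ :=
  GRing.isSubmodClosed.Build R (T -> X) (Bochner_pred p1) Bochner_submod_closed.

(* Bochner p-integrable functions, before identification of functions that are
   equal almost everywhere; [p = +oo] is allowed. *)
Record Bochner_fun : Type :=
  BochnerFun { Bochner_val :> T -> X ; _ : Bochner_val \in Bochner_pred p1 }.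

HB.instance Definition _ := [isSub for Bochner_val].
HB.instance Definition _ := gen_eqMixin Bochner_fun.
HB.instance Definition _ := gen_choiceMixin Bochner_fun.
HB.instance Definition _ := [SubChoice_isSubLmodule of Bochner_fun by <:].

End Bochner_functions.

Section Bochner_space.
Context d {T : measurableType d} {R : realType}.
Variable mu : {measure set T -> \bar R}.
Variables (p : \bar R) (p1 : (1 <= p)%E) (X : normedModType R).
Local Notation F := (Bochner_fun mu p1 X).
Implicit Types f g : F.

Lemma Bochner_funP f :
  strongly_measurable f /\ (Bochner_Lnorm mu p f < +oo)%E.
Proof. by have := valP f; rewrite inE. Qed.

Definition Bochner_null : {pred F} := mem [set f : F | \forall t \ae mu, f t = 0].

Let Bochner_null_submod_closed : submod_closed Bochner_null.
Proof.
split; first by rewrite inE; apply: nearW.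
move=> a f g; rewrite !inE => f0 g0.
by apply: filterS2 f0 g0 => t ft gt; rewrite /= -[LHS]/(a *: f t + g t) ft gt scaler0 addr0.
Qed.

HB.instance Definition _ :=
  GRing.isSubmodClosed.Build R F Bochner_null Bochner_null_submod_closed.

Definition Bochner_norm f : R := fine (Bochner_Lnorm mu p f).

Let Bochner_normK f : (Bochner_norm f)%:E = Bochner_Lnorm mu p f.
Proof.
rewrite fineK// ge0_fin_numE; last exact: Lnorm_ge0.
by have [] := Bochner_funP f.
Qed.

Let Bochner_normD f g : Bochner_norm (f + g) <= Bochner_norm f + Bochner_norm g.
Proof.
rewrite -lee_fin EFinD !Bochner_normK; apply: Bochner_LnormD => //.
- by have [] := Bochner_funP f.
- by have [] := Bochner_funP g.
Qed.

Let Bochner_normZ (a : R) f : Bochner_norm (a *: f) = `|a| * Bochner_norm f.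
Proof.
have [mf foo] := Bochner_funP f.
by apply: EFin_inj; rewrite EFinM !Bochner_normK; exact: Bochner_LnormZ.
Qed.

Let Bochner_norm_eq0 f : Bochner_norm f = 0 <-> f \in Bochner_null.
Proof.
have [/strongly_measurable_norm mf _] := Bochner_funP f.
rewrite inE; split => [f0|f0].
  have /Lnorm_eq0_eq0 : Bochner_Lnorm mu p f = 0%E by rewrite -Bochner_normK f0.
  have p0 : (0 < p)%E by rewrite (lt_le_trans _ p1).
  move=> /(_ _ p0); have /measurable_EFinP mf' := mf.
  move=> /(_ mf'); apply: filterS => t /(_ I) /= -[] /eqP.
  by rewrite normr_eq0 => /eqP.
rewrite /Bochner_norm /Bochner_Lnorm ae0_Lnorm//.
by apply: filterS f0 => t ->; rewrite normr0.
Qed.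

Definition Bochner_seminorm : seminorm Bochner_null :=
  Seminorm Bochner_normD Bochner_normZ Bochner_norm_eq0.

Definition Bochner_space : normedModType R := seminorm_quot Bochner_seminorm.

End Bochner_space.

Section real_Lspace.
Context d {T : measurableType d} {R : realType}.
Variable mu : {measure set T -> \bar R}.
Variables (p : \bar R) (p1 : (1 <= p)%E).
Local Notation F := (LfunType mu p1).
Implicit Types f g : F.

Definition Lfun_null : {pred F} := mem [set f : F | \forall t \ae mu, f t = 0].

Let Lfun_null_submod_closed : submod_closed Lfun_null.
Proof.
split; first by rewrite inE; apply: nearW.
move=> a f g; rewrite !inE => f0 g0.
by apply: filterS2 f0 g0 => t ft gt; rewrite /= -[LHS]/(a * f t + g t) ft gt mulr0 addr0.
Qed.

HB.instance Definition _ :=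
  GRing.isSubmodClosed.Build R F Lfun_null Lfun_null_submod_closed.

Definition Lfun_norm_fine f : R := fine ('N[mu]_p[EFin \o f])%E.

Let Lfun_normZ (a : R) f : Lfun_norm_fine (a *: f) = `|a| * Lfun_norm_fine f.
Proof.
apply: EFin_inj; rewrite EFinM !(finite_norm_fine); exact: LnormZ.
Qed.

Let Lfun_norm_eq0 f : Lfun_norm_fine f = 0 <-> f \in Lfun_null.
Proof.
rewrite inE; split => [/fine_Lnormr_eq0|f0].
  by apply: filterS => t /(_ I).
by rewrite /Lfun_norm_fine ae0_Lnorm.
Qed.

Definition Lfun_seminorm : seminorm Lfun_null :=
  Seminorm (@ler_LnormD _ _ _ mu p p1) Lfun_normZ Lfun_norm_eq0.

Definition real_Lspace : normedModType R := seminorm_quot Lfun_seminorm.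

End real_Lspace.

Section unit_interval.
Variable R : realType.

(* Lebesgue measure on [0, 1], carried by the whole line with the complement of
   [0, 1] a null set: functions on R modulo this measure are functions on [0, 1]
   modulo almost everywhere equality. *)
Definition unit_interval_measure : {measure set (measurableTypeR R) -> \bar R} :=
  mrestr (@lebesgue_measure R) (measurable_itv `[0%R, 1%R]).

Lemma exponent_ge1 (i : nat) : (1 <= (i.+1%:R : R)%:E)%E.
Proof. by rewrite lee_fin ler1n. Qed.

(* The exponents 1, 2, 3, ... are indexed by [nat] from 0: [Lspace01 i X] is
   L^(i+1)(X). *)
Definition Lspace01 (i : nat) (X : normedModType R) : normedModType R :=
  Bochner_space unit_interval_measure (exponent_ge1 i) X.

Definition Linfty01 : normedModType R :=
  real_Lspace unit_interval_measure (leey 1).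

End unit_interval.

Definition ultra_Lspace (R : realType) (U : set_system nat) {UU : UltraFilter U}
    (X : normedModType R) : normedModType R :=
  ultraproduct U (fun i => Lspace01 i X).

Arguments ultra_Lspace {R} U {UU} X.

Definition nonprincipal (T : Type) (U : set_system T) : Prop :=
  forall x : T, U <> principal_filter x.

(* Main.v *)
(* Averages of isometric images are taken with equal weights (n+1)^-1: a convex
   combination can be rounded to such an average at a cost depending only on
   the number of its terms and on n.  Almost transitivity and uniform
   convex-transitivity then both say that averages of n+1 isometric images of x
   come eps-close to y, uniformly in the unit vectors x and y, with n = 0 in the
   first case.  With n fixed this property passes to ultraproducts coordinate by
   coordinate, and errors tending to 0 along U disappear in the limit.

   It passes from X to L^p(X), with the same n for all p.  For simple nowhere
   zero unit functions f and g, the atomless probability measures |g|^p dt and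
   |f|^p dt are isomorphic: the quantile function of a law with a continuous
   distribution function F is a right inverse of F and transports Lebesgue
   measure to that law.  If th maps |g|^p dt to |f|^p dt and J_j^(x,y) are
   isometries of X averaging x/|x| close to y/|y|, the isometries
     u |-> (t |-> |g(t)|/|f(th t)| J_j^(f(th t),g(t)) u(th t))
   average f close to g.

   In L^infty, let A be the set where |f| > 1 - 1/(n+1).  Nonsingular involutions
   phi_j can be chosen so that the sets of t with phi_j(t) outside A are disjoint,
   by swapping a set containing the complement of A with the pieces of a
   partition of A.  Up to an error O(1/(n+1)), the average of the functions
   sigma_j f(phi_j) is then an average of n+1 arbitrary signs at each point. *)
From HB Require Import structures.
Require Import Defs.
From mathcomp Require Import all_boot all_order all_algebra.
From mathcomp Require Import all_classical all_reals all_analysis.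
From mathcomp Require Import generic_quotient measurable_realfun ess_sup_inf lra.

Set Implicit Arguments.
Unset Strict Implicit.
Unset Printing Implicit Defensive.

Import Order.TTheory GRing.Theory Num.Def Num.Theory.
Import numFieldNormedType.Exports.

Local Open Scope classical_set_scope.
Local Open Scope ring_scope.

(** * Averages of isometric images *)

Section orbit_averages.
Context {R : realType}.
Implicit Type X : normedModType R.

(* Equal weights, unlike those of [orbit_convex_combinations], can be chosen
   uniformly in a point or a coordinate on which the isometries depend; the
   number of isometries is [n.+1], so that the weight is never the junk value
   [0^-1 = 0]. *)
Definition orbit_average_dense X (n : nat) (eps : R) : Prop :=
  forall x y : X, `|x| = 1 -> `|y| = 1 ->
    exists T : 'I_n.+1 -> {linear X -> X},
      (forall j, isometric_automorphism (T j)) /\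
      `|y - n.+1%:R^-1 *: \sum_(j < n.+1) T j x| <= eps.

Lemma isometric_automorphism_id X : isometric_automorphism (idfun : {linear X -> X}).
Proof. by split=> // y; exists y. Qed.

Lemma almost_transitive_orbit_average X (eps : R) : 0 < eps ->
  almost_transitive_space X -> orbit_average_dense X 0 eps.
Proof.
move=> eps0 atX x y x1 y1.
have : closure (isometry_orbit x) y by rewrite atX.
move=> /(_ _ (nbhsx_ballx y _ eps0)) [_ [[T isoT <-]]].
rewrite -ball_normE /ball_/= => /ltW yT.
by exists (fun=> T); split => //; rewrite big_ord1 invr1 scale1r.
Qed.

Lemma orbit_average_transitive X : orbit_average_dense X 0 0 -> transitive_space X.
Proof.
move=> oX x x1; apply/seteqP; split=> y.
  by move=> [T [isoT _] <-]; rewrite /unit_sphere/= isoT.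
move=> y1; have [T [isoT]] := oX x y x1 y1.
rewrite big_ord1 invr1 scale1r normr_le0 subr_eq0 => /eqP ->.
by exists (T ord0).
Qed.

Lemma orbit_average_uct X :
  (forall eps : R, 0 < eps -> exists n, orbit_average_dense X n eps) ->
  uniformly_convex_transitive X.
Proof.
move=> oX eps eps0; have [n on] := oX _ eps0; exists n.+1 => x y x1 y1.
have [T [isoT yT]] := on x y x1 y1.
set z := n.+1%:R^-1 *: _ in yT.
have zC : orbit_convex_combinations n.+1 x z.
  exists T, (fun=> n.+1%:R^-1); split => // [_||].
  - by rewrite invr_ge0 ler0n invf_le1 ?ler1n ?ltr0n.
  - by rewrite sumr_const card_ord -[LHS]mulr_natr mulVf// pnatr_eq0.
  - by rewrite /z scaler_sumr.
apply: (@le_trans _ _ (edist (y, z))); first by apply: ereal_inf_lbound; exists z.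
(* The extended distance is controlled through open balls, so the bound is strict only after adding
   [d]. *)
apply/lee_addgt0Pr => d d0; rewrite -EFinD; apply: edist_fin => /=.
  by rewrite addr_gt0.
by rewrite -ball_normE /ball_/= (le_lt_trans yT)// ltrDl.
Qed.

(** Rounding each [N * a i] to an integer costs at most one vector of norm 1 per index, however
    large [N] is. The choice [k] precedes [f] because it depends on the weights alone. *)
Lemma equal_weights (n N : nat) (a : 'I_n -> R) :
  (forall i, 0 <= a i) -> \sum_(i < n) a i = 1 ->
  exists k : 'I_N -> 'I_n, forall X (f : 'I_n -> X),
    (forall i, `|f i| <= 1) ->
    `|N%:R *: (\sum_(i < n) a i *: f i) - \sum_(j < N) f (k j)| <= n%:R.
Proof.
move=> a0 a1.
(* The index [i] is repeated [m i] times, where the [m i] are the increments of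
   the integer parts of [N * A k]; they add up to [N] by telescoping. *)
pose A k : R := \sum_(i < n | (i < k)%N) a i.
have AS (i : 'I_n) : A i.+1 = A i + a i.
  rewrite /A (bigD1 i) ?ltnSn//= addrC; congr (_ + _).
  by apply: eq_bigl => j; rewrite ltnS -(inj_eq val_inj)/= [RHS]ltn_neqAle andbC.
have A_ge0 k : 0 <= A k by apply: sumr_ge0.
pose c k := truncn (N%:R * A k).
have cP k : (c k)%:R <= N%:R * A k < (c k).+1%:R.
  by apply: truncn_itv; rewrite mulr_ge0.
have c_nd (i : 'I_n) : (c i <= c i.+1)%N.
  by apply: le_truncn; rewrite ler_wpM2l// AS lerDl.
pose m (i : 'I_n) := (c i.+1 - c i)%N.
have m_near i : `|N%:R * a i - (m i)%:R| <= 1.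
  have := cP i; have := cP i.+1; rewrite AS natrB// -!natr1 ler_norml; lra.
have mN : \sum_(i < n) m i = N.
  rewrite -(big_mkord xpredT (fun k => c k.+1 - c k)%N) telescope_sumn_in//; last first.
    by move=> k /andP[_ kn]; exact: (c_nd (Ordinal kn)).
  have -> : c 0%N = 0%N by rewrite /c /A big_pred0// mulr0 truncn0.
  rewrite subn0 /c (_ : A n = 1) ?mulr1 ?natrK//.
  by rewrite -a1; apply: eq_bigl => i; rewrite ltn_ord.
(* [nth] needs a default index below; there is one because the weights add up to 1. *)
have n0 : (0 < n)%N.
  case: n a a1 {a0 A AS A_ge0 c cP c_nd m m_near mN} => // a.
  by rewrite big_ord0 => /eqP; rewrite eq_sym oner_eq0.
pose s := flatten [seq nseq (m i) i | i <- enum 'I_n].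
have sumS (V : nmodType) (F : 'I_n -> V) :
    \sum_(i <- s) F i = \sum_(i < n) F i *+ m i.
  rewrite big_flatten big_map big_enum; apply: eq_bigr => i _.
  by rewrite big_nseq iter_addr_0.
have size_s : size s = N.
  rewrite size_flatten /shape -map_comp sumnE big_map big_enum -[RHS]mN.
  by apply: eq_bigr => i _ /=; rewrite size_nseq.
exists (fun j => nth (Ordinal n0) s j) => X f f1.
have -> : \sum_(j < N) f (nth (Ordinal n0) s j) = \sum_(i < n) f i *+ m i.
  by rewrite -sumS (big_nth (Ordinal n0)) big_mkord size_s.
rewrite scaler_sumr -sumrB (le_trans (ler_norm_sum _ _ _))//.
have -> : n%:R = \sum_(i < n) (1 : R) by rewrite sumr_const card_ord.
apply: ler_sum => i _.
by rewrite scalerA -[f i *+ _]scaler_nat -scalerBl normrZ -[leRHS]mulr1 ler_pM.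
Qed.

Lemma uct_orbit_average X (eps : R) : 0 < eps ->
  uniformly_convex_transitive X -> exists n, orbit_average_dense X n eps.
Proof.
move=> eps0 uX; have eps20 : 0 < eps / 2 by rewrite divr_gt0.
(* The infimum in [edist_inf] may not be attained: [eps / 4] is relaxed to [eps / 2] to get an
   actual combination. The choice of [N] bounds the rounding cost [n / (N + 1)] by another
   [eps / 4]. *)
have eps40 : 0 < eps / 4 by rewrite divr_gt0.
have [n un] := uX _ eps40.
pose N := truncn (n%:R / (eps / 4)).
exists N => x y x1 y1.
have : (edist_inf (orbit_convex_combinations n x) y < (eps / 2)%:E)%E.
  by rewrite (le_lt_trans (un x y x1 y1))// lte_fin; lra.
move=> /ereal_inf_lt [_ [z [T [a [isoT a01 a1 ->]]] <-]].
move=> /edist_lt_ball; rewrite -ball_normE /ball_/= => yz.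
have a0 i : 0 <= a i by have /andP[] := a01 i.
have [k kP] := equal_weights N.+1 a0 a1.
exists (T \o k); split => [j|]; first exact: isoT.
have Tx1 i : `|T i x| <= 1 by have [-> _] := isoT i; rewrite x1.
have := kP X _ Tx1; set u := \sum_i _ in yz *; set v := \sum_j _ => uv.
have N0 : (0 : R) < N.+1%:R by rewrite ltr0n.
have -> : y - N.+1%:R^-1 *: v = (y - u) + N.+1%:R^-1 *: (N.+1%:R *: u - v).
  by rewrite scalerBr scalerA mulVf ?gt_eqF// scale1r addrA subrK.
rewrite (le_trans (ler_normD _ _))// normrZ gtr0_norm ?invr_gt0//.
suff : N.+1%:R^-1 * `|N.+1%:R *: u - v| <= eps / 4.
  by move: (N.+1%:R^-1 * _) `|y - u| yz => b c ? ?; lra.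
rewrite mulrC ler_pdivrMr// (le_trans uv)// mulrC -ler_pdivrMr// ltW//.
exact: truncnS_gt.
Qed.

(** Averages of isometries are contractions, so normalizing a vector costs the distance of its norm
    to 1. Ultraproducts need this, since the coordinates of a unit vector have norm close to 1 only
    along the ultrafilter. *)
Lemma normalized_average X n (e : R) (x y : X)
    (T : 'I_n.+1 -> {linear X -> X}) :
  x != 0 -> y != 0 -> (forall j, isometric_automorphism (T j)) ->
  `| `|y|^-1 *: y - n.+1%:R^-1 *: \sum_(j < n.+1) T j (`|x|^-1 *: x)| <= e ->
  `|y - n.+1%:R^-1 *: \sum_(j < n.+1) T j x| <= e + `|1 - `|x| | + `|1 - `|y| |.
Proof.
move=> x0 y0 isoT xye.
pose A z := n.+1%:R^-1 *: \sum_(j < n.+1) T j z.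
have AB u z : A (u - z) = A u - A z.
  by rewrite /A -scalerBr -sumrB; under eq_bigr do rewrite linearB.
have A_le z : `|A z| <= `|z|.
  rewrite /A normrZ gtr0_norm ?invr_gt0 ?ltr0n// ler_pdivrMl ?ltr0n//.
  rewrite (le_trans (ler_norm_sum _ _ _))//.
  rewrite (eq_bigr (fun=> `|z|)) => [|j _]; last by have [->] := isoT j.
  by rewrite sumr_const card_ord mulr_natl.
have unitB (z : X) : z != 0 -> `|z - `|z|^-1 *: z| = `|1 - `|z| |.
  move=> z0; rewrite -[X in X - _]scale1r -scalerBl normrZ.
  rewrite -[in X in _ * X](normr_id z) -normrM.
  by rewrite mulrBl mul1r mulVf ?normr_eq0// distrC.
have -> : y - A x = (`|y|^-1 *: y - A (`|x|^-1 *: x)) - A (x - `|x|^-1 *: x)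
    + (y - `|y|^-1 *: y).
  rewrite AB; move: (A (_ *: _)) (A x) (_ *: y) => b a c.
  by rewrite opprB (addrA (c - b)) subrK [RHS]addrC addrA subrK.
rewrite (le_trans (ler_normD _ _))// unitB// lerD2r.
by rewrite (le_trans (ler_normB _ _))// lerD// -unitB.
Qed.

End orbit_averages.

(** * Quotients and ultraproducts *)

Lemma linear_bundle (R : pzRingType) (V W : lmodType R) (tau : V -> W) :
  linear tau -> exists T : {linear V -> W}, T =1 tau.
Proof.
move=> lin; pose T : {linear V -> W} := HB.pack tau (GRing.isLinear.Build R V W _ tau lin).
by exists T.
Qed.

Section seminorm_quot_isometry.
Context {R : realType} {V : lmodType R} {N : submodClosed V} (q : seminorm N).

Lemma seminormN v : q (- v) = q v.
Proof. by rewrite -scaleN1r seminormZ normrN1 mul1r. Qed.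

Lemma seminorm_ge0 v : 0 <= q v.
Proof.
have := seminormD q v (- v); rewrite seminormN subrr.
have -> : q 0 = 0 by apply/seminorm_eq0; rewrite rpred0.
lra.
Qed.

(** A linear map preserving [q] preserves its null space and so descends to classes; surjectivity,
    too, matters only up to the null space. *)
Lemma seminorm_quot_isometry (tau : V -> V) :
  linear tau -> (forall v, q (tau v) = q v) ->
  (forall w, exists v, q (tau v - w) = 0) ->
  exists T : {linear seminorm_quot q -> seminorm_quot q},
    isometric_automorphism T /\
    forall v, T (quot_class q v) = quot_class q (tau v).
Proof.
move=> lin_tau iso_tau surj_tau.
have tauB u v : tau (u - v) = tau u - tau v.
  by rewrite addrC -scaleN1r lin_tau scaleN1r addrC.
pose t (x : seminorm_quot q) : seminorm_quot q :=
   quot_class q (tau (repr (x : Quotient.quot (zmod_of_submod N)))).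
have tE v : t (quot_class q v) = quot_class q (tau v).
  apply/quot_classP/(seminorm_eq0 q).
  rewrite -tauB iso_tau; apply/seminorm_eq0/quot_classP.
  exact: quot_classK.
have classZ a v : quot_class q (a *: v) = a *: quot_class q v.
  by rewrite -quot_scaleE.
have lin_t : linear t.
  move=> a x y; rewrite -(quot_classK x) -(quot_classK y).
  by rewrite -classZ -quot_classD !tE lin_tau quot_classD classZ.
have [T Tt] := linear_bundle lin_t.
exists T; split=> [|v]; last by rewrite Tt.
split=> [x|y].
  by rewrite Tt -(quot_classK x) tE !norm_quot_class.
rewrite -(quot_classK y); set w := repr _.
have [v vw] := surj_tau w; exists (quot_class q v); rewrite Tt tE.
exact/quot_classP/(seminorm_eq0 q).
Qed.

Lemma quot_class_avg n (v w : V) (T : 'I_n -> {linear seminorm_quot q -> seminorm_quot q})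
   (tau : 'I_n -> V -> V) (a : R) :
  (forall j, T j (quot_class q v) = quot_class q (tau j v)) ->
  `|quot_class q w - a *: \sum_(j < n) T j (quot_class q v)| =
  q (w - a *: \sum_(j < n) tau j v).
Proof.
move=> Ttau; rewrite -norm_quot_class; congr (`| _ |).
have classZ b u : quot_class q (b *: u) = b *: quot_class q u.
  by rewrite -quot_scaleE.
rewrite quot_classD; congr (_ + _); rewrite -!scaleNr classZ; congr (_ *: _).
rewrite (eq_bigr _ (fun j _ => Ttau j)).
elim/big_rec2 : _ => [|j x y _ ->]; last by rewrite quot_classD.
by apply: (addIr (quot_class q 0)); rewrite -quot_classD !add0r.
Qed.

End seminorm_quot_isometry.

Section seminorm_quot_orbit_average.
Context {R : realType} {V : lmodType R} {N : submodClosed V} (q : seminorm N).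

Definition seminorm_isometry (tau : V -> V) : Prop :=
  [/\ linear tau, forall v, q (tau v) = q v &
      forall w, exists v, q (tau v - w) = 0].

(** All isometries below can thus be built on sequences or functions instead of their classes. *)
Lemma seminorm_quot_orbit_average n (eps : R) :
  (forall v w, q v = 1 -> q w = 1 -> exists tau : 'I_n.+1 -> V -> V,
     (forall j, seminorm_isometry (tau j)) /\
     q (w - n.+1%:R^-1 *: \sum_(j < n.+1) tau j v) <= eps) ->
  orbit_average_dense (seminorm_quot q) n eps.
Proof.
move=> h x y; rewrite -(quot_classK x) -(quot_classK y) !norm_quot_class => x1 y1.
have [tau [isotau yx]] := h _ _ x1 y1.
have /choice[T TP] j : exists T : {linear seminorm_quot q -> seminorm_quot q},
    isometric_automorphism T /\
    forall v, T (quot_class q v) = quot_class q (tau j v).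
  by have [lin iso surj] := isotau j; exact: seminorm_quot_isometry.
exists T; split=> [j|]; first by have [] := TP j.
rewrite (quot_class_avg _ _ (tau := tau))// => j.
by have [_ ->] := TP j.
Qed.

End seminorm_quot_orbit_average.

Section ultraproduct_orbit_average.
Context {R : realType} (U : set_system nat) {UU : UltraFilter U}.
Variable E : nat -> normedModType R.
Local Notation q := (quotient_seminorm (@ultranull_closed R U UU E)).

(** Cancelling the coordinates larger than [c] amounts to adding an ultranull element, since they
    lie off a set of the ultrafilter. With the next two lemmas, this identifies the quotient norm
    with the limit of the norms of the coordinates along [U]. *)
Lemma ultra_norm_le (y : linfty_sum E) (c : R) : 0 <= c ->
  (\forall i \near U, `|y i| <= c) -> q y <= c.
Proof.
move=> c0 yc.
have [M hM] := linfty_bounded y.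
pose n i : E i := if `|y i| <= c then 0 else - y i.
have nb : has_ubound (range (fun i => `|n i|)).
  exists M => _ [i _ <-]; rewrite /n; case: ifPn => _; last first.
    by rewrite normrN; apply: hM; exists i.
  by rewrite normr0; apply: le_trans (hM `|y i| _) => //; exists i.
have nN : LinftySum nb \in @ultranull R U E.
  apply/ultranullP/cvgrPdist_le => e e0.
  by apply: filterS yc => i yi; rewrite /= /n yi normr0 subrr normr0 ltW.
apply: (@le_trans _ _ `|y + LinftySum nb|).
  apply: ge_inf; last by exists (LinftySum nb).
  by exists 0 => _ [n' _ <-].
rewrite norm_linfty_sumE; apply: ge_sup; first by exists `|(y + LinftySum nb) 0%N|, 0%N.
move=> _ [i _ <-] /=; rewrite /n.
by case: ifPn => [|_]; rewrite ?addr0// subrr normr0.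
Qed.

Lemma ultra_norm_lt (y : linfty_sum E) (c : R) :
  q y < c -> \forall i \near U, `|y i| < c.
Proof.
move=> yc.
have hinf : [set `|y + n| | n in [set` @ultranull R U E]] !=set0.
  by exists `|y + 0|, 0 => //=; rewrite rpred0.
have [_ [n /= nN <-] ync] := inf_lt hinf yc.
have /ultranullP/cvgrPdist_lt/(_ (c - `|y + n|)) := nN.
rewrite subr_gt0 => /(_ ync); apply: filterS => i; rewrite sub0r normrN normr_id => ni.
rewrite -[y i](addrK (n i)) (le_lt_trans (ler_normB _ _))//.
by have := linfty_coord_le_norm (y + n) i; rewrite /=; lra.
Qed.

Lemma ultra_norm_ge (y : linfty_sum E) (c : R) :
  c < q y -> \forall i \near U, c <= `|y i|.
Proof.
move=> cy.
have [c0|c0] := ltP c 0; first by apply: nearW => i; rewrite (le_trans (ltW c0)).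
have [//|/= yc] := in_ultra_setVsetC [set i | c <= `|y i|] UU.
have qyc : q y <= c.
  apply: ultra_norm_le => //; apply: filterS yc => i /=.
  by move/negP; rewrite -ltNge => /ltW.
by move: cy; rewrite ltNge qyc.
Qed.

(** The isometries are chosen coordinate by coordinate, which is possible because their number is
    the same everywhere. The quotient norm sees only limits along [U], so the slack [d] and the
    deviation of the coordinates from norm 1 both disappear. *)
Lemma ultraproduct_orbit_average n (eps : R) (e : nat -> R) :
  0 <= eps -> (forall d : R, 0 < d -> \forall i \near U, e i <= eps + d) ->
  (forall i, orbit_average_dense (E i) n (e i)) ->
  orbit_average_dense (ultraproduct U E) n eps.
Proof.
move=> eps0 e_eps oE; apply: (@seminorm_quot_orbit_average _ _ _ q) => v w v1 w1.
have exT i : exists T : 'I_n.+1 -> {linear E i -> E i},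
    (forall j, isometric_automorphism (T j)) /\
    (v i != 0 -> w i != 0 ->
     `|w i - n.+1%:R^-1 *: \sum_(j < n.+1) T j (v i)| <=
       e i + `|1 - `|v i| | + `|1 - `|w i| |).
  have [vw0|/norP[v0 w0]] := boolP ((v i == 0) || (w i == 0)).
    (* A zero coordinate cannot be normalized; the identity is a default value there. *)
    exists (fun=> idfun); split => [j|v0 w0]; first exact: isometric_automorphism_id.
    by rewrite (negbTE v0) (negbTE w0) in vw0.
  have unit (X : normedModType R) (z : X) : z != 0 -> `| `|z|^-1 *: z| = 1.
    by move=> z0; rewrite normrZ normfV normr_id mulVf// normr_eq0.
  have [T [isoT xy]] := oE i _ _ (unit _ _ v0) (unit _ _ w0).
  by exists T; split=> // _ _; exact: normalized_average.
pose T i := sval (cid (exT i)); have TP i := svalP (cid (exT i)).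
have bT j (y : linfty_sum E) : has_ubound (range (fun i => `|T i j (y i)|)).
  have [M hM] := linfty_bounded y; exists M => _ [i _ <-].
  by have [/(_ j) [-> _] _] := TP i; apply: hM; exists i.
pose tau j y := LinftySum (bT j y).
exists tau; split=> [j|].
  have iso_i i (y : E i) : `|T i j y| = `|y|.
    by have [/(_ j) [-> _] _] := TP i.
  have q_le (y z : linfty_sum E) : (forall i, `|y i| = `|z i|) -> q y <= q z.
    move=> yz; apply/ler_addgt0Pr => d d0.
    have q0 : 0 <= q z + d.
      rewrite addr_ge0 ?(ltW d0)//; exact: seminorm_ge0.
    apply: ultra_norm_le => //.
    have : q z < q z + d by rewrite ltrDl.
    by move=> /ultra_norm_lt; apply: filterS => i; rewrite yz => /ltW.
  split.
  - by move=> a y z; apply: linfty_sumP => i /=; rewrite linearP.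
  - by move=> y; apply/eqP; rewrite eq_le !q_le// => i /=; rewrite iso_i.
  - move=> y.
    have exz i : exists z, T i j z = y i.
      by have [/(_ j) [_ surj] _] := TP i; exact: surj.
    pose z i := sval (cid (exz i)); have zP i : T i j (z i) = y i := svalP (cid (exz i)).
    have bz : has_ubound (range (fun i => `|z i|)).
      have [M hM] := linfty_bounded y; exists M => _ [i _ <-].
      by rewrite -(iso_i i) zP; apply: hM; exists i.
    exists (LinftySum bz); apply/seminorm_eq0.
    rewrite (_ : _ - _ = 0) ?rpred0//.
    by apply: linfty_sumP => i /=; rewrite zP subrr.
apply/ler_addgt0Pr => d d0.
have d30 : 0 < d / 3 by rewrite divr_gt0.
(* The minimum with 1 forces these coordinates to be nonzero. *)
have near1 (y : linfty_sum E) : q y = 1 ->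
    \forall i \near U, `|1 - `|y i| | < minr (d / 3) 1.
  move=> y1; set m := minr _ _; have m0 : 0 < m by rewrite lt_min d30 ltr01.
  have y_lt : q y < 1 + m by rewrite y1 ltrDl.
  have y_gt : 1 - m / 2 < q y by rewrite y1; lra.
  move: (ultra_norm_lt y_lt) (ultra_norm_ge y_gt).
  by apply: filterS2 => i h1 h2; rewrite ltr_norml; lra.
have coord_sum i : (w - n.+1%:R^-1 *: \sum_(j < n.+1) tau j v) i =
    w i - n.+1%:R^-1 *: \sum_(j < n.+1) T i j (v i).
  rewrite /=; congr (_ - _ *: _).
  by elim/big_rec2 : _ => //= j y z _ ->.
apply: ultra_norm_le; first by rewrite addr_ge0// ltW.
move: (near1 v v1) (near1 w w1) (e_eps _ d30).
apply: filterS3 => i; rewrite !lt_min => /andP[vd v01] /andP[wd w01] ed.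
have neq0 (X : normedModType R) (z : X) : `|1 - `|z| | < 1 -> z != 0.
  by apply: contraTN => /eqP ->; rewrite normr0 subr0 normr1 ltxx.
rewrite coord_sum; have [_ /(_ (neq0 _ _ v01) (neq0 _ _ w01))] := TP i.
by move/le_trans; apply; lra.
Qed.

End ultraproduct_orbit_average.

(** * Isomorphism of atomless laws *)

Section density_measure.
Context d {T : measurableType d} {R : realType}.
Variables (mu : {measure set T -> \bar R}) (h : T -> R).
Hypotheses (h0 : forall t, 0 <= h t) (mh : measurable_fun setT h).

Definition density_measure (A : set T) : \bar R := (\int[mu]_(t in A) (h t)%:E)%E.

Let mhE (A : set T) : measurable_fun A (fun t => (h t)%:E).
Proof. by apply/measurable_EFinP; exact: measurable_funTS. Qed.

Let density0 : density_measure set0 = 0%E.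
Proof. exact: integral_set0. Qed.

Let density_ge0 A : (0 <= density_measure A)%E.
Proof. by apply: integral_ge0 => t _; rewrite lee_fin. Qed.

Let density_sigma_additive : semi_sigma_additive density_measure.
Proof.
move=> F mF tF mUF; rewrite /density_measure; apply: cvg_toP.
  apply: ereal_nondecreasing_is_cvgn => m n mn.
  by apply: lee_sum_nneg_natr => // k _ _; exact: density_ge0.
by rewrite ge0_integral_bigcup// => t _; rewrite lee_fin.
Qed.

HB.instance Definition _ := isMeasure.Build _ _ _ density_measure
  density0 density_ge0 density_sigma_additive.

Import HBNNSimple.

(** For an indicator this is the definition of [density_measure]; finite sums give simple functions,
    and monotone convergence the rest. *)
Lemma ge0_integral_density (k : T -> \bar R) : (forall t, 0 <= k t)%E ->
  measurable_fun setT k ->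
  (\int[density_measure]_t k t = \int[mu]_t (k t * (h t)%:E))%E.
Proof.
move=> k0 mk.
pose s := nnsfun_approx measurableT mk.
have sk t : (s n t)%:E @[n --> \oo] --> k t by exact: cvg_nnsfun_approx.
have msE n : measurable_fun setT (fun t => (s n t)%:E) by apply/measurable_EFinP.
transitivity (limn (fun n => \int[density_measure]_t (s n t)%:E)%E).
  rewrite -monotone_convergence//.
  - by apply: eq_integral => t _; apply/esym/cvg_lim.
  - by move=> n t _; rewrite lee_fin.
  - by move=> t _ m n mn; rewrite lee_fin; exact/lefP/nd_nnsfun_approx.
transitivity (limn (fun n => \int[mu]_t ((s n t)%:E * (h t)%:E))%E); last first.
  rewrite -monotone_convergence//.
  - apply: eq_integral => t _; apply/cvg_lim => //.
    by apply: cvgeZr.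
  - by move=> n; exact: emeasurable_funM.
  - by move=> n t _; rewrite mule_ge0// lee_fin.
  - by move=> t _ m n mn; rewrite lee_wpmul2r ?lee_fin//; exact/lefP/nd_nnsfun_approx.
congr (limn _); apply/funext => n.

transitivity (\int[density_measure]_t (\sum_(y \in range (s n))
    (y * \1_(s n @^-1` [set y]) t)%:E))%E.
  by apply: eq_integral => t _; rewrite fsumEFin// -fimfunE.
rewrite ge0_integral_fsum//; last 2 first.
  - by move=> y; exact/measurable_EFinP/measurable_funM.
  - by move=> y x _; rewrite nnfun_muleindic_ge0.
transitivity (\int[mu]_t (\sum_(y \in range (s n))
    (y * \1_(s n @^-1` [set y]) t)%:E * (h t)%:E))%E; last first.
  apply: eq_integral => t _; rewrite -ge0_mule_fsuml => [|y].
    by rewrite fsumEFin// -fimfunE.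
  exact: nnfun_muleindic_ge0.
rewrite ge0_integral_fsum//; last 2 first.
  - by move=> y; apply: emeasurable_funM => //; exact/measurable_EFinP/measurable_funM.
  - by move=> y x _; apply: mule_ge0; [exact: nnfun_muleindic_ge0|rewrite lee_fin].
apply: eq_fsbigr => y /[!inE] -[t0 _ <-].
rewrite integralZl_indic_nnsfun// integral_indic// setIT.
under [RHS]eq_integral do rewrite EFinM -muleA.
rewrite ge0_integralZl//; last 3 first.
  - by apply: emeasurable_funM => //; exact/measurable_EFinP.
  - by move=> t _; rewrite mule_ge0 ?lee_fin.
  - by rewrite lee_fin.
congr (_ * _)%E.
rewrite -[LHS]/(\int[mu]_(t in s n @^-1` [set s n t0]) (h t)%:E)%E [LHS]integral_mkcond.
by apply: eq_integral => t _; rewrite epatch_indic muleC.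
Qed.

Hypothesis h1 : (\int[mu]_t (h t)%:E = 1)%E.

HB.instance Definition _ :=
  Measure_isProbability.Build _ _ R density_measure h1.

Lemma exists_density_probability :
  exists P : probability T R,
    (forall A, P A = \int[mu]_(t in A) (h t)%:E)%E /\
    (forall k : T -> \bar R, (forall t, 0 <= k t)%E -> measurable_fun setT k ->
      \int[P]_t k t = \int[mu]_t (k t * (h t)%:E))%E.
Proof.
by exists density_measure; split=> //; exact: ge0_integral_density.
Qed.

End density_measure.

(** Open upper rays are stable under intersection and generate the Borel sets. *)
Lemma probability_eq_itv (R : realType) (P1 P2 : probability (measurableTypeR R) R) :
  (forall x : R, P1 `]x, +oo[%classic = P2 `]x, +oo[%classic) ->
  forall A, measurable A -> P1 A = P2 A.
Proof.
move=> P12 A mA.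
apply: (@measure_unique _ R (measurableTypeR R) (@RGenOInfty.G R)
  (fun k => `](- k%:R), +oo[%classic) _ _ _ _ P1 P2) => //.
- exact: RGenOInfty.measurableE.
- move=> _ _ [x ->] [y ->]; exists (maxr x y); apply/seteqP; split => t /=;
    rewrite !in_itv/= !andbT gt_max; [by move=> [-> ->]|by move=> /andP[]].
- by move=> k; exists (- k%:R).
- apply/seteqP; split => // t _; exists (truncn (- t)).+1 => //=.
  by rewrite in_itv/= andbT ltrNl truncnS_gt.
- by move=> _ [x ->]; exact: P12.
- by move=> k; rewrite (le_lt_trans (probability_le1 _ _))// ltry.
Qed.

(** * Quantile functions of atomless laws *)

Section quantile.
Context {R : realType}.
Local Notation lam := (unit_interval_measure R).

Lemma unit_interval_measureE (A : set (measurableTypeR R)) :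
  lam A = lebesgue_measure (A `&` `[0, 1]).
Proof. by []. Qed.

Lemma unit_interval_measure_setT : lam [set: measurableTypeR R] = 1%E.
Proof.
rewrite unit_interval_measureE setTI lebesgue_measure_itv/= lte_fin ltr01.
by rewrite oppr0 adde0.
Qed.

Lemma unit_interval_measure_set1 (t : R) : lam [set t] = 0%E.
Proof. by apply: countable_lebesgue_measure0; exact/finite_set_countable/finite_setIl. Qed.

Lemma unit_interval_measureC_Ioo : lam (~` `]0%R, 1%R[) = 0%E.
Proof.
apply: countable_lebesgue_measure0; apply: (@sub_countable _ _ _ [set (0 : R); 1]).
  apply: subset_card_le => t /= [/negP]; rewrite !in_itv/= negb_and -!leNgt.
  move=> /orP[t0|t1] /andP[t0' t1']; [left|right].
    by apply/le_anti; rewrite t0 t0'.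
  by apply/le_anti; rewrite t1 t1'.
apply: finite_set_countable; exact: finite_set2.
Qed.

Lemma unit_interval_measure_Ioo (c : R) : 0 <= c <= 1 ->
  lam `]c, 1[%classic = (1 - c)%:E.
Proof.
move=> /andP[c0 c1].
rewrite unit_interval_measureE setIidl; last first.
  move=> t /=; rewrite !in_itv/= => /andP[ct t1].
  by rewrite (le_trans c0 (ltW ct)) ltW.
rewrite lebesgue_measure_itv/= lte_fin EFinB; case: ltP => // c1'.
by rewrite (@le_anti _ _ c 1) ?c1 ?c1'// subee.
Qed.

Variable P : probability (measurableTypeR R) R.

(** Continuity from above; it yields the limits of [F] at both ends of the line and its continuity
    at the quantiles. *)
Lemma probability_bigcap_ge (F : (set (measurableTypeR R))^nat) (c : \bar R) :
  (forall n, measurable (F n)) -> (forall m n, (m <= n)%N -> F n `<=` F m) ->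
  (forall n, c <= P (F n))%E -> (c <= P (\bigcap_n F n))%E.
Proof.
move=> mF ndF cF.
have cvgF : P (F n) @[n --> \oo] --> P (\bigcap_n F n).
  apply: nonincreasing_cvg_mu => //.
  - by rewrite (le_lt_trans (probability_le1 _ _))// ltry.
  - exact: bigcap_measurable.
  - by move=> m n mn; apply/subsetPset/ndF.
rewrite -(cvg_lim _ cvgF)//; apply: lime_ge; first by apply/cvg_ex; eexists; exact: cvgF.
exact: nearW.
Qed.

Hypothesis P1 : forall t : R, P [set t] = 0%E.

Let F (t : R) : R := fine (P `]-oo, t]%classic).

Let FE t : (F t)%:E = P `]-oo, t]%classic.
Proof. by rewrite fineK// fin_num_measure. Qed.

Let FcE t : (1 - F t)%:E = P `]t, +oo[%classic.
Proof. by rewrite EFinB FE -probability_setC// setCitvl. Qed.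

Let F01 t : 0 <= F t <= 1.
Proof. by rewrite -!lee_fin FE measure_ge0 probability_le1. Qed.

Let F_nd s t : s <= t -> F s <= F t.
Proof.
move=> st; rewrite -lee_fin !FE; apply: le_measure; rewrite ?inE//.
exact: subset_itvl.
Qed.

(** Together with [F_gt], this makes the infimum defining [Q s] one of a nonempty set that is
    bounded below, for [s] in the open unit interval. *)
Let F_lt (s : R) : 0 < s -> exists t, F t < s.
Proof.
move=> s0; apply: contrapT => /forallNP h.
suff : (s%:E <= P set0)%E by rewrite measure0 lee_fin leNgt s0.
have <- : \bigcap_n `]-oo, (- n%:R : R)]%classic = set0.
  rewrite -subset0 => t /(_ (truncn (- t)).+1 I) /=.
  by rewrite in_itv/= leNgt ltrNl truncnS_gt.
apply: probability_bigcap_ge => // [m n mn|n].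
  by apply: subset_itvl; rewrite bnd_simp lerN2 ler_nat.
by rewrite -FE lee_fin leNgt; exact/negP.
Qed.

Let F_gt (s : R) : s < 1 -> exists t, s < F t.
Proof.
move=> s1; apply: contrapT => /forallNP h.
suff : ((1 - s)%:E <= P set0)%E by rewrite measure0 lee_fin subr_le0 leNgt s1.
have <- : \bigcap_n `]n%:R : R, +oo[%classic = set0.
  rewrite -subset0 => t /(_ (truncn t).+1 I) /=.
  by rewrite in_itv/= andbT ltNge ltW// truncnS_gt.
apply: probability_bigcap_ge => // [m n mn|n].
  by apply: subset_itvr; rewrite bnd_simp ler_nat.
by rewrite -FcE lee_fin lerB// leNgt; exact/negP.
Qed.

(* The value [0] outside of the open unit interval is arbitrary. *)
Let Q (s : R) : R := if 0 < s < 1 then inf [set t | s <= F t] else 0.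

Let Q_le (s t : R) : 0 < s < 1 -> s <= F t -> Q s <= t.
Proof.
move=> s01 sFt; rewrite /Q s01; apply: ge_inf => //.
move: s01 => /andP[/F_lt[u Fu] _]; exists u => v /= sFv.
by rewrite leNgt; apply/negP => /ltW/F_nd; rewrite leNgt (lt_le_trans Fu).
Qed.

Let lt_Q (s t : R) : 0 < s < 1 -> t < Q s -> F t < s.
Proof. by move=> s01; apply: contraTT; rewrite -!leNgt; exact: Q_le. Qed.

Let Q_lt (s t : R) : 0 < s < 1 -> Q s < t -> s <= F t.
Proof.
move=> s01; rewrite /Q s01 => /inf_lt[|u /= sFu ut].
  by move: s01 => /andP[_ /F_gt[u su]]; exists u; exact: ltW.
by rewrite (le_trans sFu)// F_nd// ltW.
Qed.

(* Right continuity of [F] gives [s <= F (Q s)], the absence of atoms [F (Q s) <= s]. *)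
Let FQ (s : R) : 0 < s < 1 -> F (Q s) = s.
Proof.
move=> s01; apply/eqP; rewrite eq_le; apply/andP; split; last first.
  rewrite -lee_fin FE (itvNycEbigcap false); apply: probability_bigcap_ge => // [m n mn|n].
    by apply: subset_itvl; rewrite bnd_simp lerD2l lef_pV2 ?posrE// ler_nat.
  by rewrite -FE lee_fin Q_lt// ltrDl.
(* The upper bound is read on complements, as [1 - s <= P ]Q s, +oo[]. Adding the endpoint, which
   has mass zero, turns the ray into an intersection of larger rays. *)
rewrite -(lerD2l (- 1)) -lerN2 !opprD !opprK -lee_fin FcE.
have -> : P `]Q s, +oo[%classic = P `[Q s, +oo[%classic.
  rewrite -[in RHS](@setU1itv _ _ +oo%O (Q s) false)// setUC measureU0//; exact: P1.
rewrite itvcyEbigcap; apply: probability_bigcap_ge => // [m n mn|n].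
  by apply: subset_itvr; rewrite bnd_simp lerD2l lerN2 lef_pV2 ?posrE// ler_nat.
by rewrite -FcE lee_fin lerD2l lerN2 ltW// lt_Q// ltrBlDr ltrDl.
Qed.

Let mF : @measurable_fun _ _ (measurableTypeR R) (measurableTypeR R) setT F.
Proof. exact: nondecreasing_measurable. Qed.

(** On the open unit interval, [t < Q s] is equivalent to [F t < s]; the second piece comes from the
    default value 0 of [Q] elsewhere. *)
Let QE t : Q @^-1` `]t, +oo[ =
  `]F t, 1[ `&` `]0, 1[ `|` (if t < 0 then ~` `]0, 1[ else set0).
Proof.
apply/seteqP; split => s /=; rewrite !in_itv/= !andbT.
  have [s01 tQ|s01] := boolP (0 < s < 1).
    by left; rewrite (lt_Q s01 tQ); split => //; case/andP : s01.
  by rewrite /Q (negbTE s01) => ->; right; rewrite /= in_itv/=; apply/negP.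
move=> [[/andP[Fs _] s01]|].
  (* If [Q s = t], then [FQ] gives [F t = s], against [F t < s]. *)
  by rewrite ltNge; apply/negP; rewrite le_eqVlt => /predU1P[Qst|/(Q_lt s01)];
    [move: Fs; rewrite -Qst FQ// ltxx|rewrite leNgt Fs].
by case: ifPn => // t0 /=; rewrite in_itv/= => /negP/negbTE s01; rewrite /Q s01.
Qed.

Let mQ : @measurable_fun _ _ (measurableTypeR R) (measurableTypeR R) setT Q.
Proof.
apply: (measurability _ (@RGenOInfty.measurableE R)) => // _ [_ [t ->] <-].
rewrite setTI QE; apply: measurableU.
  by apply: measurableI.
by case: ifP => // _; apply: measurableC.
Qed.

(** Up to a null set, [Q] exceeds [t] on the interval []F t, 1[], whose measure [1 - F t] is that of
    the ray beyond [t] under [P]; rays determine a law. *)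
Lemma quantile_transform : exists F Q : measurableTypeR R -> measurableTypeR R,
  [/\ measurable_fun setT F, measurable_fun setT Q,
      forall A, measurable A -> lam (Q @^-1` A) = P A &
      forall s, 0 < s < 1 -> F (Q s) = s].
Proof.
exists F, Q; split => // A mA.
pose Q' : {mfun measurableTypeR R >-> measurableTypeR R} :=
  HB.pack Q (@isMeasurableFun.Build _ _ (measurableTypeR R) (measurableTypeR R) Q mQ).
pose lamP : probability (measurableTypeR R) R :=
  HB.pack (Measure.sort lam)
    (Measure_isProbability.Build _ _ _ lam unit_interval_measure_setT).
suff lamQP (t : R) : lam (Q @^-1` `]t, +oo[) = P `]t, +oo[%classic.
  exact: (@probability_eq_itv R (distribution lamP Q') P lamQP A mA).
rewrite -FcE QE measureU0; last 3 first.
- exact: measurableI.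
- by case: ifP => // _; apply: measurableC.
- by case: ifP => // _; exact: unit_interval_measureC_Ioo.
rewrite -unit_interval_measure_Ioo// setIidl// => s /=; rewrite !in_itv/=.
by move=> /andP[Fts ->]; rewrite andbT (le_lt_trans _ Fts)//; case/andP : (F01 t).
Qed.
End quantile.

(** * Transport between atomless laws, and between densities *)

Section transport.
Context {R : realType}.
Local Notation lam := (unit_interval_measure R).
Local Notation T := (measurableTypeR R).

(** Both laws are compared with [lam], and the isomorphism is [Q2 \o F1]. Since [F (Q s) = s], each
    claim becomes an identity on the open unit interval once it is pulled back by a quantile
    function. *)
Lemma atomless_isomorphism (P1 P2 : probability T R) :
  (forall t : R, P1 [set t] = 0%E) -> (forall t : R, P2 [set t] = 0%E) ->
  exists th th' : T -> T,
  [/\ measurable_fun setT th, measurable_fun setT th',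
      forall A, measurable A -> P1 (th @^-1` A) = P2 A,
      forall A, measurable A -> P2 (th' @^-1` A) = P1 A &
      {ae P1, forall t, th' (th t) = t} /\ {ae P2, forall t, th (th' t) = t}].
Proof.
move=> P10 P20.
have [F1 [Q1 [mF1 mQ1 Q1E FQ1]]] := quantile_transform P10.
have [F2 [Q2 [mF2 mQ2 Q2E FQ2]]] := quantile_transform P20.
have mpre (f : T -> T) A : measurable_fun setT f -> measurable A -> measurable (f @^-1` A).
  by move=> mf mA; rewrite -[_ @^-1` _]setTI; exact: mf.
(* [lam] does not charge the complement of the open unit interval, where [F (Q s)] is not
   controlled. *)
have lam_eq (A B : set T) : measurable A -> measurable B ->
    (forall s, 0 < s < 1 -> A s <-> B s) -> lam A = lam B.
  move=> mA mB AB.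
  have Ioo (C : set T) : measurable C -> lam C = lam (C `&` `]0, 1[%classic).
    move=> mC; rewrite -[in LHS](setUIDK C `]0, 1[%classic) measureU0//.
    + exact: measurableI.
    + exact: measurableD.
    + apply: (@subset_measure0 _ _ _ lam _ (~` `]0%R, 1%R[%classic)) => //.
      * exact: measurableD.
      * exact: measurableC.
      * exact: unit_interval_measureC_Ioo.
  rewrite (Ioo A)// (Ioo B)//; congr (lam _).
  by apply/seteqP; split => s [/= h s01]; split => //; apply/AB => //; rewrite in_itv in s01.
have push (P P' : probability T R) (F Q Q' : T -> T) :
    measurable_fun setT F -> measurable_fun setT Q -> measurable_fun setT Q' ->
    (forall A, measurable A -> lam (Q @^-1` A) = P A) ->
    (forall s, 0 < s < 1 -> F (Q s) = s) ->
    (forall A, measurable A -> lam (Q' @^-1` A) = P' A) ->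
    forall A, measurable A -> P ((Q' \o F) @^-1` A) = P' A.
  move=> mF mQ mQ' QE FQ Q'E A mA.
  have mQF : measurable_fun setT (Q' \o F) by exact: measurableT_comp.
  rewrite -(QE _ (mpre _ _ mQF mA)).
  rewrite -Q'E//; apply: lam_eq.
  - exact: (mpre _ _ mQ (mpre _ _ mQF mA)).
  - exact: mpre.
  - by move=> s s01 /=; rewrite FQ.
(* [P] is carried by the values [Q s], and there the composite runs through [Q s], [s], [Q' s], [s]
   and back to [Q s]. *)
have inv (P : probability T R) (F Q F' Q' : T -> T) :
    measurable_fun setT F -> measurable_fun setT Q ->
    measurable_fun setT F' -> measurable_fun setT Q' ->
    (forall A, measurable A -> lam (Q @^-1` A) = P A) ->
    (forall s, 0 < s < 1 -> F (Q s) = s) ->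
    (forall s, 0 < s < 1 -> F' (Q' s) = s) ->
    {ae P, forall t, (Q \o F') ((Q' \o F) t) = t}.
  move=> mF mQ mF' mQ' QE FQ FQ'.
  pose B : set T := [set t | (Q \o F') ((Q' \o F) t) == t].
  have mB : measurable B.
    have mf : measurable_fun setT ((Q \o F') \o (Q' \o F)).
      by apply: measurableT_comp; apply: measurableT_comp.
    have mid : measurable_fun setT (idfun : T -> T) by exact: measurable_id.
    rewrite -[B]setTI.
    exact: (measurable_fun_eqr mf mid measurableT (Y := [set true])).
  suff PB : P (~` B) = 0%E.
    have aeB : almost_everywhere P B by exists (~` B); split => //; exact: measurableC mB.
    by apply: filterS aeB => t /eqP.
  rewrite -(QE _ (measurableC mB)).
  rewrite (lam_eq _ set0) ?measure0//.
  - exact: (mpre _ _ mQ (measurableC mB)).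
  - by move=> s s01; split => // /negP; rewrite /B /= FQ// FQ'// eqxx.
exists (Q2 \o F1), (Q1 \o F2); split.
- exact: measurableT_comp.
- exact: measurableT_comp.
- exact: (push P1 P2 F1 Q1 Q2).
- exact: (push P2 P1 F2 Q2 Q1).
- by split; [exact: inv|exact: inv].
Qed.

Variable mu : {measure set T -> \bar R}.
Hypothesis mu1 : forall t : R, mu [set t] = 0%E.

(** On a set that is null for the law of density [h], the function [h] vanishes almost everywhere;
    this turns statements about [P] into statements about [mu]. *)
Lemma atomless_density (h : T -> R) : (forall t, 0 <= h t) ->
  measurable_fun setT h -> (\int[mu]_t (h t)%:E = 1)%E ->
  exists P : probability T R,
    [/\ forall t : R, P [set t] = 0%E,
        forall k : T -> \bar R, (forall t, 0 <= k t)%E -> measurable_fun setT k ->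
          (\int[P]_t k t = \int[mu]_t (k t * (h t)%:E))%E &
        forall A, {ae P, forall t, A t} -> {ae mu, forall t, h t != 0 -> A t}].
Proof.
move=> h0 mh h1.
have mhE : measurable_fun setT (fun t => (h t)%:E) by exact/measurable_EFinP.
have [P [PE intP]] := exists_density_probability h0 mh h1.
exists P; split=> [t|//|A].
  rewrite PE; apply: null_set_integral => //.
  exact: measurable_funTS.
move=> [B [mB PB AB]].
have : (\int[mu]_(t in B) `|(h t)%:E| = 0)%E.
  rewrite -[RHS]PB PE.
  by apply: eq_integral => t _; rewrite gee0_abs ?lee_fin.
move/(ae_eq_integral_abs mu mB (measurable_funTS mhE)).
apply: filterS => t ht ht0; apply: contrapT => At.
have /ht [h_eq0] := AB t At.
by rewrite h_eq0 eqxx in ht0.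
Qed.

(** The isomorphism of the two laws is expressed through [mu] only, so that it serves directly as a
    change of variables. *)
Lemma density_transport (h1 h2 : T -> R) :
  (forall t, 0 <= h1 t) -> (forall t, 0 <= h2 t) ->
  measurable_fun setT h1 -> measurable_fun setT h2 ->
  (\int[mu]_t (h1 t)%:E = 1)%E -> (\int[mu]_t (h2 t)%:E = 1)%E ->
  exists th th' : T -> T,
  [/\ measurable_fun setT th /\ measurable_fun setT th',
      forall k : T -> \bar R, (forall t, 0 <= k t)%E -> measurable_fun setT k ->
        (\int[mu]_t (k (th t) * (h1 t)%:E) = \int[mu]_t (k t * (h2 t)%:E))%E,
      forall k : T -> \bar R, (forall t, 0 <= k t)%E -> measurable_fun setT k ->
        (\int[mu]_t (k (th' t) * (h2 t)%:E) = \int[mu]_t (k t * (h1 t)%:E))%E,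
      {ae mu, forall t, h1 t != 0 -> th' (th t) = t} &
      {ae mu, forall t, h2 t != 0 -> th (th' t) = t}].
Proof.
move=> h10 h20 mh1 mh2 i1 i2.
have [P1 [P1_0 P1int P1ae]] := atomless_density h10 mh1 i1.
have [P2 [P2_0 P2int P2ae]] := atomless_density h20 mh2 i2.
have [th [th' [mth mth' thE th'E [thK thK']]]] := atomless_isomorphism P1_0 P2_0.
have change (P P' : probability T R) (f : T -> T) (k : T -> \bar R) :
    measurable_fun setT f -> (forall A, measurable A -> P (f @^-1` A) = P' A) ->
    (forall t, 0 <= k t)%E -> measurable_fun setT k ->
    (\int[P]_t k (f t) = \int[P']_t k t)%E.
  move=> mf fE k0 mk.
  transitivity (\int[pushforward P f]_t k t)%E.
    by rewrite ge0_integral_pushforward// preimage_setT.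
  by apply: eq_measure_integral => A mA _; exact: fE.
exists th, th'; split=> [//|k k0 mk|k k0 mk||].
- rewrite -P2int// -(change P1 P2 th)// P1int//.
  exact: measurableT_comp.
- rewrite -P1int// -(change P2 P1 th')// P2int//.
  exact: measurableT_comp.
- exact: P1ae.
- exact: P2ae.
Qed.
End transport.

(** * Bochner spaces *)

Section strongly_measurable_operations.
Context d {T : measurableType d} {R : realType} (X : normedModType R).
Implicit Types u : T -> X.

Lemma vsimple_strongly_measurable u : vsimple u -> strongly_measurable u.
Proof. by move=> su; exists (fun=> u); split => // t; exact: cvg_cst. Qed.

(** The map [L (k t)] varies with [t] among finitely many maps. [K] carries no sigma-algebra, hence
    the condition on fibres. *)
Lemma vsimple_op (K : Type) (k : T -> K) (L : K -> X -> X) u :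
  finite_set (range k) -> (forall z, measurable (k @^-1` [set z])) ->
  vsimple u -> vsimple (fun t => L (k t) (u t)).
Proof.
move=> fink mk su; split; first by apply: (finite_image11 L) => //; case: su.
move=> z.
rewrite (_ : _ @^-1` _ = \bigcup_(c in range k)
    (k @^-1` [set c] `&` u @^-1` (L c @^-1` [set z]))).
  apply: fin_bigcup_measurable => // c _; apply: measurableI => //.
  exact: vsimple_preimage.
apply/seteqP; split=> t /=.
  by move=> Lz; exists (k t); [exists t|].
by move=> [c _ [/= -> ->]].
Qed.

Lemma strongly_measurable_op (K : Type) (k : T -> K) (L : K -> X -> X) u :
  finite_set (range k) -> (forall z, measurable (k @^-1` [set z])) ->
  (forall z, continuous (L z)) -> strongly_measurable u ->
  strongly_measurable (fun t => L (k t) (u t)).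
Proof.
move=> fink mk cL [s [ss su]]; exists (fun n t => L (k t) (s n t)).
split=> [n|t]; first exact: vsimple_op.
by apply: cvg_comp (su t) _; exact: cL.
Qed.

Lemma strongly_measurable_comp (phi : T -> T) u : measurable_fun setT phi ->
  strongly_measurable u -> strongly_measurable (u \o phi).
Proof.
move=> mphi [s [ss su]]; exists (fun n => s n \o phi).
split=> [n|t]; last exact: su.
have [fin_s ms] := ss n; split.
  by apply: sub_finite_set fin_s => _ [t _ <-]; exists (phi t).
move=> x; rewrite -[X in measurable X]setTI.
exact: (mphi measurableT (s n @^-1` [set x])).
Qed.

Lemma finite_range_pair (K K' : Type) (k : T -> K) (k' : T -> K') :
  finite_set (range k) -> finite_set (range k') ->
  finite_set (range (fun t => (k t, k' t))).
Proof. by move=> fk fk'; apply: (finite_image11 pair). Qed.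

Lemma measurable_preimage_pair (K K' : Type) (k : T -> K) (k' : T -> K') z :
  (forall x, measurable (k @^-1` [set x])) ->
  (forall x, measurable (k' @^-1` [set x])) ->
  measurable ((fun t => (k t, k' t)) @^-1` [set z]).
Proof.
case: z => x y mk mk'.
rewrite (_ : _ @^-1` _ = k @^-1` [set x] `&` k' @^-1` [set y]).
  exact: measurableI.
by apply/seteqP; split=> t /= [-> ->].
Qed.

End strongly_measurable_operations.

Section Bochner_power.
Context d {T : measurableType d} {R : realType}.
Variables (mu : {measure set T -> \bar R}) (p : R) (p1 : (1 <= p%:E)%E).
Variable X : normedModType R.
Implicit Types u v : T -> X.

(** The [p]-th power of the norm: without the root, a change of variables applies to it directly. *)
Definition power_integral u : \bar R := (\int[mu]_t (`|u t| `^ p)%:E)%E.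

Let p_gt0 : 0 < p.
Proof. by rewrite (lt_le_trans ltr01)// -lee_fin. Qed.

Lemma power_integral_ge0 u : (0 <= power_integral u)%E.
Proof. by apply: integral_ge0 => t _; rewrite lee_fin powR_ge0. Qed.

Lemma Bochner_LnormE u :
  Bochner_Lnorm mu p%:E u = (power_integral u `^ p^-1)%E.
Proof.
rewrite /Bochner_Lnorm unlock; congr (_ `^ _)%E.
by apply: eq_integral => t _ /=; rewrite normr_id.
Qed.

Lemma power_integralE u : power_integral u = (Bochner_Lnorm mu p%:E u `^ p)%E.
Proof.
by rewrite Bochner_LnormE -poweRrM mulVf ?gt_eqF// poweRe1// power_integral_ge0.
Qed.

Local Notation q := (Bochner_seminorm mu p1 X).

Lemma Bochner_seminormE (f : Bochner_fun mu p1 X) :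
  (q f)%:E = Bochner_Lnorm mu p%:E f.
Proof.
rewrite -[q f]/(fine _) fineK// ge0_fin_numE; last exact: Lnorm_ge0.
by have [] := Bochner_funP f.
Qed.

Lemma power_integral_seminorm (f : Bochner_fun mu p1 X) :
  power_integral f = (q f `^ p)%:E.
Proof. by rewrite power_integralE -Bochner_seminormE poweR_EFin. Qed.

Lemma Bochner_seminorm_le (f : Bochner_fun mu p1 X) (c : R) : 0 <= c ->
  (power_integral f <= (c `^ p)%:E)%E -> q f <= c.
Proof.
move=> c0; rewrite power_integral_seminorm lee_fin => h.
have := @ge0_ler_powR R p^-1 _ (q f `^ p) (c `^ p).
rewrite invr_ge0 (ltW p_gt0) !nnegrE !powR_ge0 => /(_ erefl erefl erefl h).
by rewrite -!powRrM mulfV ?gt_eqF// !powRr1//; exact: seminorm_ge0.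
Qed.

Lemma Bochner_fun_of_power u : strongly_measurable u ->
  (power_integral u < +oo)%E -> u \in Bochner_pred mu p1.
Proof. by move=> mu_ uoo; rewrite inE; split=> //; rewrite Bochner_LnormE poweR_lty. Qed.

Lemma Bochner_seminorm_pointwise (f g : Bochner_fun mu p1 X) :
  (forall t, `|f t| <= `|g t|) -> q f <= q g.
Proof.
move=> fg; rewrite -lee_fin !Bochner_seminormE; apply: le_Lnorm => //.
- by apply: strongly_measurable_norm; case: (Bochner_funP f).
- by apply: strongly_measurable_norm; case: (Bochner_funP g).
- by move=> t; rewrite !normr_id.
Qed.

Lemma Bochner_fun_sumE n (F : 'I_n -> Bochner_fun mu p1 X) t :
  (\sum_(j < n) F j : Bochner_fun mu p1 X) t = \sum_(j < n) F j t.
Proof. by elim/big_rec2 : _ => // j x f _ <-. Qed.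

End Bochner_power.

(** * Weighted composition operators *)

Section weighted_composition.
Context d {T : measurableType d} {R : realType}.
Variables (mu : {measure set T -> \bar R}) (p : R).
Variables (X : normedModType R) (f g : T -> X) (th : T -> T) (L : X -> X -> X -> X).
Implicit Type u : T -> X.

(** [L] stands for the isometries indexed by pairs of values of [f] and [g], and also for their
    inverses, which are given as mere functions; hence its type without linearity. The scalar
    compensates the change of density. *)
Definition weighted_composition u : T -> X :=
  fun t => (`|g t| / `|f (th t)|) *: L (f (th t)) (g t) (u (th t)).

Hypotheses (sf : vsimple f) (sg : vsimple g) (mth : measurable_fun setT th).
Hypothesis f0 : forall t, f t != 0.
Hypothesis thE : forall k : T -> \bar R, (forall t, 0 <= k t)%E -> measurable_fun setT k ->
  (\int[mu]_t (k (th t) * (`|g t| `^ p)%:E) = \int[mu]_t (k t * (`|f t| `^ p)%:E))%E.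
Hypothesis normL : forall x y v, `|L x y v| = `|v|.
Hypothesis contL : forall x y, continuous (L x y).

Lemma vsimple_measurable_comp d' (T' : measurableType d') (F : X -> T') :
  measurable_fun setT (F \o f).
Proof.
by move=> _ B mB; rewrite setTI comp_preimage; exact: vsimple_preimage.
Qed.

Lemma strongly_measurable_weighted u : strongly_measurable u ->
  strongly_measurable (weighted_composition u).
Proof.
move=> mu_.
have sfth : vsimple (f \o th).
  have [fin_f mf] := sf; split.
    by apply: sub_finite_set fin_f => _ [t _ <-]; exists (th t).
  move=> x; rewrite -[X in measurable X]setTI.
  exact: (mth measurableT (mf x)).
have [finf mf] := sfth; have [fing mg] := sg.
apply: (strongly_measurable_op (k := fun t => ((f \o th) t, g t))
  (L := fun z v => (`|z.2| / `|z.1|) *: L z.1 z.2 v)).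
- exact: finite_range_pair.
- by move=> z; exact: measurable_preimage_pair.
- by move=> z v; apply: cvgZr; exact: contL.
- exact: strongly_measurable_comp.
Qed.

(** The change of variables is applied to the [p]-th power of [|u| / |f|]: the scalar supplies the
    density of [g] before it, and the density of [f] cancels the denominator after it. *)
Lemma power_integral_weighted u : 0 < p -> strongly_measurable u ->
  power_integral mu p (weighted_composition u) = power_integral mu p u.
Proof.
move=> p0 mu_; pose k t : \bar R := ((`|u t| / `|f t|) `^ p)%:E.
have k0 t : (0 <= k t)%E by rewrite lee_fin powR_ge0.
have mk : measurable_fun setT k.
  apply/measurable_EFinP; apply: (measurableT_comp (measurable_powR p)).
  apply: measurable_funM; first exact: strongly_measurable_norm.
  exact: (vsimple_measurable_comp (fun x => `|x|^-1)).
transitivity (\int[mu]_t (k (th t) * (`|g t| `^ p)%:E))%E.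
  apply: eq_integral => t _; rewrite /k -EFinM -powRM ?divr_ge0//.
  by rewrite normrZ normL normrM normfV !normr_id mulrC mulrA mulrAC.
rewrite thE//; apply: eq_integral => t _; rewrite /k -EFinM -powRM ?divr_ge0//.
by rewrite divfK// normr_eq0.
Qed.

End weighted_composition.

Lemma isometric_automorphism_inverse (R : realType) (X : normedModType R)
    (T : {linear X -> X}) : isometric_automorphism T ->
  exists S : X -> X, [/\ cancel S T, forall x, `|S x| = `|x| & continuous S].
Proof.
move=> [isoT /choice[S TS]]; exists S.
have isoS x : `|S x| = `|x| by rewrite -isoT TS.
split=> // x; apply/cvgrPdist_lt => e e0; near=> y.
have -> : `|S x - S y| = `|x - y| by rewrite -isoT linearB !TS.
by near: y; exact: cvgr_dist_lt.
Unshelve. all: by end_near. Qed.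

Lemma isometric_automorphism_continuous (R : realType) (X : normedModType R)
    (T : {linear X -> X}) : isometric_automorphism T -> continuous T.
Proof.
move=> [isoT _] x; apply/cvgrPdist_lt => e e0; near=> y.
rewrite -linearB isoT; near: y; exact: cvgr_dist_lt.
Unshelve. all: by end_near. Qed.

(** * Density of nowhere zero simple functions *)

Section simple_approximation.
Context d {T : measurableType d} {R : realType}.
Variables (mu : {measure set T -> \bar R}) (p : R) (p1 : (1 <= p%:E)%E).
Hypothesis mu_fin : (mu setT < +oo)%E.
Variable X : normedModType R.
Local Notation q := (Bochner_seminorm mu p1 X).

Let p_gt0 : 0 < p.
Proof. by rewrite (lt_le_trans ltr01)// -lee_fin. Qed.

(** A simple approximant is kept where it is nonzero and at most twice as large as [u], and replaced
    by a small multiple of [x0] elsewhere. The cutoff provides a dominating function. *)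
Lemma nowhere_zero_approximation (u : T -> X) (x0 : X) : `|x0| = 1 ->
  strongly_measurable u ->
  exists w : nat -> T -> X,
    [/\ forall n, vsimple (w n), forall n t, w n t != 0,
        forall n t, `|u t - w n t| <= 3 * `|u t| + 1 &
        forall t, w n t @[n --> \oo] --> u t].
Proof.
move=> x01 smu; have [s [ss su]] := smu.
have mnu := strongly_measurable_norm smu.
pose b n t := (0 < `|s n t|) && (`|s n t| <= 2 * `|u t|).
have mb n : measurable_fun setT (b n).
  have mns := strongly_measurable_norm (vsimple_strongly_measurable (ss n)).
  apply: measurable_and; first exact: measurable_fun_ltr.
  by apply: measurable_fun_ler => //; exact: measurable_funM.
pose c n : R := n.+1%:R^-1.
have c01 n : 0 < c n <= 1 by rewrite /c invr_gt0 ltr0n invf_le1 ?ltr0n// ler1n.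
exists (fun n t => if b n t then s n t else c n *: x0); split.
- move=> n; apply: (@vsimple_op _ _ _ _ _ (b n) (fun z v => if z then v else c n *: x0)) => //.
  + by move=> z; rewrite -[X in measurable X]setTI; exact: (mb n).
- move=> n t; case: ifPn => [/andP[]|_]; first by rewrite normr_gt0.
  rewrite scaler_eq0 negb_or -normr_gt0 -[x0 == 0]normr_eq0 x01 oner_eq0 andbT.
  by have /andP[c0 _] := c01 n; rewrite normr_gt0 gt_eqF.
- move=> n t; rewrite (le_trans (ler_normB _ _))//; case: ifPn => [/andP[_]|_].
    by have := normr_ge0 (u t); lra.
  rewrite normrZ x01 mulr1 ger0_norm; last by have /andP[/ltW] := c01 n.
  by have /andP[_] := c01 n; have := normr_ge0 (u t); lra.
(* Where [u] vanishes, the cutoff always selects [c n *: x0], which tends to 0; elsewhere it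
   eventually keeps [s n t]. *)
- move=> t; have [ut0|ut0] := eqVneq (u t) 0.
    apply/cvgrPdist_lt => e e0; rewrite ut0.
    have : c n @[n --> \oo] --> (0 : R) by exact: cvg_harmonic.
    move/cvgrPdist_lt => /(_ _ e0); apply: filterS => n.
    rewrite !sub0r !normrN ifF; first by rewrite normrZ x01 mulr1.
    rewrite /b ut0 normr0 mulr0; apply/negbTE; rewrite negb_and -leNgt.
    by rewrite -ltNge; case: ltP.
  have u0 : 0 < `|u t| / 2 by rewrite divr_gt0// normr_gt0.
  apply: cvg_trans (su t); apply: near_eq_cvg.
  have /cvgrPdist_lt/(_ _ u0) := su t; apply: filterS => n un.
  rewrite ifT// /b.
  have h1 : `|u t| <= `|u t - s n t| + `|s n t|.
    by rewrite -[in leLHS](subrK (s n t) (u t)) ler_normD.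
  have h2 : `|s n t| <= `|u t| + `|u t - s n t|.
    by rewrite -[in leLHS](subKr (u t) (s n t)) ler_normB.
  by apply/andP; split; lra.
Qed.

(** The two terms come from two cases: [y <= 2] if [3 * x <= 1], and [y <= 6 * x] otherwise. *)
Lemma powR_dominated (x y : R) : 0 <= x -> 0 <= y -> y <= 3 * x + 1 ->
  y `^ p <= 6 `^ p * x `^ p + 2 `^ p.
Proof.
move=> x0 y0 yx; have p0 := ltW p_gt0.
have [x1|x1] := leP (3 * x) 1.
  apply: (@le_trans _ _ (2 `^ p)); last by rewrite lerDr mulr_ge0// powR_ge0.
  by rewrite ge0_ler_powR ?nnegrE//; lra.
apply: (@le_trans _ _ (6 `^ p * x `^ p)); last by rewrite lerDl powR_ge0.
by rewrite -powRM// ge0_ler_powR ?nnegrE ?mulr_ge0//; lra.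
Qed.

(** Dominated convergence, with the bound of [powR_dominated]; its constant term is integrable
    because [mu] is finite. *)
Lemma dense_simple (f : Bochner_fun mu p1 X) (x0 : X) (e : R) : `|x0| = 1 -> 0 < e ->
  exists g : Bochner_fun mu p1 X,
    [/\ vsimple g, forall t, g t != 0 & q (f - g) <= e].
Proof.
move=> x01 e0; have [smf _] := Bochner_funP f.
have [w [sw w0 wf cvgw]] := nowhere_zero_approximation x01 smf.
have smw n : strongly_measurable (f \- w n).
  have := strongly_measurable_lin (-1) (vsimple_strongly_measurable (sw n)) smf.
  by congr (strongly_measurable _); apply/funext => t /=; rewrite !fctE scaleN1r addrC.
have mpow (v : T -> X) : strongly_measurable v ->
    measurable_fun setT (fun t => (`|v t| `^ p)%:E).
  move=> smv; apply/measurable_EFinP; apply: (measurableT_comp (measurable_powR p)).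
  exact: strongly_measurable_norm.
have intf : mu.-integrable setT (fun t => (`|f t| `^ p)%:E).
  apply/integrableP; split; first exact: mpow.
  under eq_integral do rewrite gee0_abs ?lee_fin ?powR_ge0//.
  by rewrite -/(power_integral mu p f) power_integral_seminorm ltry.
have [] := @dominated_convergence _ _ _ mu setT measurableT
  (fun n t => (`|f t - w n t| `^ p)%:E) (cst 0%E)
  (fun t => ((6 `^ p)%:E * (`|f t| `^ p)%:E + (2 `^ p)%:E))%E.
- by move=> n; exact: mpow (smw n).
- exact: measurable_cst.
- apply: nearW => t _; rewrite -[X in _ --> X]/((0 : R)%:E).
  apply: cvg_EFin; first exact: nearW.
  apply/cvgrPdist_lt => r r0; have rp0 : 0 < r `^ p^-1 by rewrite powR_gt0.
  have /cvgrPdist_lt/(_ _ rp0) := cvgw t; apply: filterS => n ftw.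
  rewrite sub0r normrN ger0_norm ?powR_ge0//.
  have -> : r = (r `^ p^-1) `^ p by rewrite -powRrM mulVf ?gt_eqF// powRr1// ltW.
  by rewrite gt0_ltr_powR ?nnegrE ?powR_ge0.
- apply: integrableD => //; first exact: integrableZl.
  apply/integrableP; split => //.
  by rewrite integral_cst// lte_mul_pinfty// ltry.
- apply: nearW => t n _; rewrite gee0_abs ?lee_fin ?powR_ge0//.
  exact: powR_dominated.
move=> _ _; rewrite integral0 => cvg0.
have ep0 : 0 < e `^ p by rewrite powR_gt0.
have [n fwn] : exists n, (power_integral mu p (f \- w n)%R <= (e `^ p)%:E)%E.
  apply: contrapT => /forallNP h.
  have : ((e `^ p)%:E <= 0)%E.
    rewrite -(cvg_lim _ cvg0)//; apply: lime_ge; first by apply/cvg_ex; exists 0%E.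
    by apply: nearW => n; rewrite leNgt; apply/negP => /ltW /(h n).
  by rewrite lee_fin leNgt ep0.
have wF : w n \in Bochner_pred mu p1.
  have fwF : f \- w n \in Bochner_pred mu p1.
    by apply: (Bochner_fun_of_power p1 (smw n)); rewrite (le_lt_trans fwn)// ltry.
  have -> : w n = -1 *: (f \- w n) + f.
    by apply/funext => t; rewrite !fctE scaleN1r opprB subrK.
  by have [_ closed_lin] := Bochner_submod_closed mu p1 X; apply: closed_lin => //; exact: (valP f).
exists (BochnerFun wF); split; [exact: sw|exact: w0|].
exact: (Bochner_seminorm_le (f := f - BochnerFun wF) (ltW e0) fwn).
Qed.

Lemma dense_simple_unit (f : Bochner_fun mu p1 X) (e : R) : q f = 1 -> 0 < e ->
  exists g : Bochner_fun mu p1 X,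
    [/\ vsimple g, forall t, g t != 0, q g = 1 & q (f - g) <= e].
Proof.
move=> f1 e0.
have [t ft0] : exists t, f t != 0.
  apply: contrapT => /forallNP f0; suff : q f <= q 0.
    by have -> : q 0 = 0; [apply/seminorm_eq0; rewrite rpred0|rewrite f1 ler10].
  by apply: Bochner_seminorm_pointwise => t; have /negP/negPn/eqP -> := f0 t; rewrite normr0.
have x01 : `| `|f t|^-1 *: f t| = 1.
  by rewrite normrZ normfV normr_id mulVf// normr_eq0.
(* Half of [e] pays for the approximation and half for the normalization; the bound [1 / 2] keeps
   [q g] positive. *)
pose r := minr (e / 2) (1 / 2).
have r0 : 0 < r by rewrite lt_min !divr_gt0.
have re : r <= e / 2 by rewrite ge_min lexx.
have r1 : r <= 1 / 2 by rewrite ge_min lexx orbT.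
have [g [sg g0 fg]] := dense_simple f x01 r0.
have qfg : q f <= q (f - g) + q g by rewrite -[in leLHS](subrK g f) seminormD.
have qgf : q g <= q f + q (f - g).
  by rewrite -[in leLHS](subKr f g) -(seminormN q (f - g)) seminormD.
have qg0 : 0 < q g by lra.
exists ((q g)^-1 *: g); split.
- apply: (@vsimple_op _ _ _ _ _ (cst tt) (fun _ v => (q g)^-1 *: v)) => // -[].
  by rewrite preimage_cst; case: ifP.
- by move=> t'; rewrite /= scaler_eq0 negb_or invr_eq0 gt_eqF//=; exact: g0.
- by rewrite seminormZ gtr0_norm ?invr_gt0// mulVf// gt_eqF.
have -> : f - (q g)^-1 *: g = (f - g) + (1 - (q g)^-1) *: g.
  by rewrite scalerBl scale1r addrA subrK.
rewrite (le_trans (seminormD _ _ _))// seminormZ.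
rewrite -[X in _ + _ * X](gtr0_norm qg0) -normrM mulrBl mul1r mulVf ?gt_eqF//.
suff : `|q g - 1| <= r by lra.
by rewrite ler_norml; lra.
Qed.

End simple_approximation.

(** * Averages of isometries of Bochner spaces *)

Section Bochner_orbit_average.
Context {R : realType}.
Local Notation T := (measurableTypeR R).
Variable mu : {measure set T -> \bar R}.
Hypotheses (mu1 : forall t : R, mu [set t] = 0%E) (mu_fin : (mu setT < +oo)%E).
Variables (p : R) (p1 : (1 <= p%:E)%E) (X : normedModType R).
Local Notation F := (Bochner_fun mu p1 X).
Local Notation q := (Bochner_seminorm mu p1 X).

Let p_gt0 : 0 < p.
Proof. by rewrite (lt_le_trans ltr01)// -lee_fin. Qed.

Lemma weighted_composition_fun (f g : F) (th : T -> T) (L : X -> X -> X -> X) :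
  vsimple f -> vsimple g -> measurable_fun setT th -> (forall t, f t != 0) ->
  (forall k : T -> \bar R, (forall t, 0 <= k t)%E -> measurable_fun setT k ->
    (\int[mu]_t (k (th t) * (`|g t| `^ p)%:E) =
     \int[mu]_t (k t * (`|f t| `^ p)%:E))%E) ->
  (forall x y v, `|L x y v| = `|v|) -> (forall x y, continuous (L x y)) ->
  exists tau : F -> F, (forall u, tau u = weighted_composition f g th L u :> (T -> X)) /\
    forall u, q (tau u) = q u.
Proof.
move=> sf sg mth f0 thE nL cL.
have smw (u : F) : strongly_measurable (weighted_composition f g th L u).
  by apply: strongly_measurable_weighted => //; have [] := Bochner_funP u.
have piw (u : F) : power_integral mu p (weighted_composition f g th L u) = power_integral mu p u.
  by apply: power_integral_weighted => //; have [] := Bochner_funP u.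
have wF (u : F) : weighted_composition f g th L u \in Bochner_pred mu p1.
  apply: Bochner_fun_of_power => //.
  by rewrite piw power_integral_seminorm ltry.
exists (fun u => BochnerFun (wF u)); split=> // u.
apply: EFin_inj; rewrite !Bochner_seminormE.
by rewrite !Bochner_LnormE; congr (_ `^ _)%E; exact: piw.
Qed.

(** At almost every point the argument is that of [X] scaled by [|g t|]: the average misses [g t] by
    at most [eps * |g t|], whence the error [eps * q g = eps]. *)
Lemma simple_orbit_average n (eps : R) (f g : F) : 0 <= eps ->
  orbit_average_dense X n eps ->
  vsimple f -> vsimple g -> (forall t, f t != 0) -> (forall t, g t != 0) ->
  q f = 1 -> q g = 1 ->
  exists tau : 'I_n.+1 -> F -> F, (forall j, seminorm_isometry q (tau j)) /\
    q (g - n.+1%:R^-1 *: \sum_(j < n.+1) tau j f) <= eps.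
Proof.
move=> eps0 oX sf sg f0 g0 f1 g1.
have power_simple (h : F) : q h = 1 -> vsimple h ->
    measurable_fun setT (fun t => `|h t| `^ p) /\ (\int[mu]_t (`|h t| `^ p)%:E = 1)%E.
  move=> h1 sh; split.
    apply: (measurableT_comp (measurable_powR p)); apply: strongly_measurable_norm.
    exact: vsimple_strongly_measurable.
  by rewrite -/(power_integral mu p h) power_integral_seminorm h1 powR1.
have [mf If] := power_simple _ f1 sf; have [mg Ig] := power_simple _ g1 sg.
have pow0 (h : F) t : 0 <= `|h t| `^ p by exact: powR_ge0.
have [th [th' [[mth mth'] thE th'E thK _]]] :=
  density_transport mu1 (pow0 g) (pow0 f) mg mf Ig If.
(* [g] vanishes nowhere, so its density restricts nothing. *)
have {}thK : {ae mu, forall t, th' (th t) = t}.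
  apply: filterS thK => t; apply.
  by rewrite gt_eqF// powR_gt0// normr_gt0.
have unit (x : X) : x != 0 -> `| `|x|^-1 *: x| = 1.
  by move=> x0; rewrite normrZ normfV normr_id mulVf// normr_eq0.
(* Choosing the isometries once for each pair of vectors makes them depend on [t] only through the
   simple functions [f \o th] and [g]; this keeps [tau j u] strongly measurable. *)
have exJ (z : X * X) : exists J : 'I_n.+1 -> {linear X -> X},
    (forall j, isometric_automorphism (J j)) /\
    (z.1 != 0 -> z.2 != 0 -> `| `|z.2|^-1 *: z.2 - n.+1%:R^-1 *:
      \sum_(j < n.+1) J j (`|z.1|^-1 *: z.1)| <= eps).
  have [z0|/norP[z10 z20]] := boolP ((z.1 == 0) || (z.2 == 0)).
    exists (fun=> idfun); split => [j|z10 z20]; first exact: isometric_automorphism_id.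
    by rewrite (negbTE z10) (negbTE z20) in z0.
  by have [J [isoJ Jz]] := oX _ _ (unit _ z10) (unit _ z20); exists J.
have [J JP] := choice exJ.
have isoJ z j : isometric_automorphism (J z j) by have [] := JP z.
have exS (zj : X * X * 'I_n.+1) : exists S : X -> X,
    [/\ cancel S (J zj.1 zj.2), forall x, `|S x| = `|x| & continuous S].
  exact: isometric_automorphism_inverse.
have [S SP] := choice exS.
have extau (j : 'I_n.+1) : exists tau : F -> F,
    (forall u, tau u = weighted_composition f g th (fun x y => J (x, y) j) u :> (T -> X)) /\
    forall u, q (tau u) = q u.
  apply: weighted_composition_fun => //.
    by move=> x y v; have [->] := isoJ (x, y) j.
  by move=> x y; exact: isometric_automorphism_continuous.
have [tau tauP] := choice extau.
have tauE j u t : tau j u t = (`|g t| / `|f (th t)|) *: J (f (th t), g t) j (u (th t)).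
  by have [-> _] := tauP j.
exists tau; split=> [j|].
  split; last first.
  - move=> w.
    (* A preimage of [w] is obtained by exchanging [f] with [g] and [th] with [th'], and inverting
       the isometries pointwise. *)
    have [tau' [tau'E _]] : exists tau' : F -> F,
        (forall u, tau' u =
          weighted_composition g f th' (fun y x => S ((x, y), j)) u :> (T -> X)) /\
        forall u, q (tau' u) = q u.
      apply: weighted_composition_fun => //.
        by move=> x y v; have [_ ->] := SP ((y, x), j).
      by move=> x y; have [] := SP ((y, x), j).
    exists (tau' w); apply/(seminorm_eq0 q); rewrite inE.
    apply: filterS thK => t thK.
    rewrite -[LHS]/(tau j (tau' w) t - w t) tauE tau'E /weighted_composition thK.
    rewrite linearZ/= scalerA; have [-> _ _] := SP ((f (th t), g t), j).
    rewrite mulrA divfK ?normr_eq0// divff ?normr_eq0// scale1r subrr//.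
  - by have [_] := tauP j.
  - move=> a u v; apply: val_inj; apply/funext => t.
    rewrite -[RHS]/(a *: tau j u t + tau j v t) /= !tauE.
    rewrite -[(a *: u + v) (th t)]/(a *: u (th t) + v (th t)) linearP/= scalerDr.
    by rewrite !scalerA [_ * a]mulrC.
apply: (@le_trans _ _ (q (eps *: g))); last by rewrite seminormZ g1 mulr1 ger0_norm.
apply: Bochner_seminorm_pointwise => t.
rewrite -[_ t]/(g t - n.+1%:R^-1 *: (\sum_(j < n.+1) tau j f) t) Bochner_fun_sumE.
rewrite -[(eps *: g) t]/(eps *: g t) normrZ ger0_norm//.
under eq_bigr do rewrite tauE.
have [_ /(_ (f0 _) (g0 _))] := JP (f (th t), g t); rewrite /=.
set z := (f (th t), g t) => Jfg.
have -> : g t - n.+1%:R^-1 *: (\sum_(j < n.+1) (`|g t| / `|f (th t)|) *: J z j (f (th t))) =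
  `|g t| *: (`|g t|^-1 *: g t - n.+1%:R^-1 *:
      \sum_(j < n.+1) J z j (`|f (th t)|^-1 *: f (th t))).
  rewrite scalerBr scalerA mulfV ?normr_eq0// scale1r; congr (_ - _).
  rewrite scalerA [in RHS]mulrC -scalerA; congr (_ *: _); rewrite scaler_sumr.
  by apply: eq_bigr => j _; rewrite linearZ/= scalerA.
by rewrite normrZ normr_id mulrC ler_wpM2r.
Qed.

(** The isometries found for simple approximants of [f] and [g] serve for [f] and [g] themselves:
    their average is a contraction, so each approximation costs at most [e / 2]. *)
Lemma Bochner_orbit_average n (eps e : R) : 0 <= eps -> 0 < e ->
  orbit_average_dense X n eps -> orbit_average_dense (Bochner_space mu p1 X) n (eps + e).
Proof.
move=> eps0 e0 oX; apply: seminorm_quot_orbit_average => f g f1 g1.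
have e20 : 0 < e / 2 by rewrite divr_gt0.
have [f' [sf f0 f'1 ff']] := dense_simple_unit mu_fin f1 e20.
have [g' [sg g0 g'1 gg']] := dense_simple_unit mu_fin g1 e20.
have [tau [isotau taufg]] := simple_orbit_average eps0 oX sf sg f0 g0 f'1 g'1.
exists tau; split=> //.
pose A h := n.+1%:R^-1 *: \sum_(j < n.+1) tau j h.
have AD : A f = A f' + A (f - f').
  rewrite /A -scalerDr -big_split/=; congr (_ *: _); apply: eq_bigr => j _.
  have [lin _ _] := isotau j; have := lin 1 f' (f - f').
  by rewrite !scale1r [f' + _]addrC subrK.
have qsum m (G : 'I_m -> F) : q (\sum_(j < m) G j) <= \sum_(j < m) q (G j).
  elim/big_rec2 : _ => [|j x y _ yx]; last by rewrite (le_trans (seminormD _ _ _))// lerD2l.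
  by have -> : q 0 = 0 by apply/seminorm_eq0; rewrite rpred0.
have qA h : q (A h) <= q h.
  rewrite /A seminormZ gtr0_norm ?invr_gt0 ?ltr0n// ler_pdivrMl ?ltr0n//.
  rewrite (le_trans (qsum _ _))//.
  rewrite (eq_bigr (fun=> q h)) => [|j _]; last by have [_ ->] := isotau j.
  by rewrite sumr_const card_ord mulr_natl.
have -> : g - A f = (g - g') + ((g' - A f') - A (f - f')).
  rewrite AD; move: (A f') (A _) => a b.
  by rewrite opprD (addrA (g - g')) (addrA (g - g')) subrK addrA.
rewrite (le_trans (seminormD _ _ _))// [in leRHS](splitr e) addrCA.
rewrite lerD// (le_trans (seminormD _ _ _))// seminormN lerD//.
exact: le_trans (qA _) ff'.
Qed.

End Bochner_orbit_average.

(** * The space of essentially bounded functions *)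

Section Linfty_isometry.
Context d {T : measurableType d} {R : realType}.
Variable mu : {measure set T -> \bar R}.
Hypothesis mu_gt0 : (0 < mu setT)%E.
Local Notation F := (LfunType mu (leey 1)).
Local Notation q := (Lfun_seminorm mu (leey 1)).

Lemma Linfty_seminormE (f : F) :
  (q f)%:E = ess_sup mu (fun t => `|f t|%:E).
Proof.
have -> : (q f)%:E = 'N[mu]_+oo%E[EFin \o f]%E.
  by rewrite -[q f]/(fine _) finite_norm_fine.
by rewrite unlock mu_gt0; congr (ess_sup mu _).
Qed.

Lemma Linfty_seminormP (f : F) (c : R) :
  q f <= c <-> {ae mu, forall t, `|f t| <= c}.
Proof.
rewrite -lee_fin Linfty_seminormE; split=> [/ess_supP|h].
  by apply: filterS => t; rewrite lee_fin.
by apply/ess_supP; apply: filterS h => t; rewrite lee_fin.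
Qed.

Lemma ae_bounded_Lfun (u : T -> R) (c : R) : measurable_fun setT u ->
  {ae mu, forall t, `|u t| <= c} -> u \in Lfun mu +oo%E.
Proof.
move=> mu_ uc; apply/andP; rewrite !inE; split => //.
rewrite /= /finite_norm unlock mu_gt0.
rewrite (@le_lt_trans _ _ c%:E)// ?ltry//.
by apply/ess_supP; apply: filterS uc => t; rewrite lee_fin.
Qed.

Lemma Lfun_sumE n (G : 'I_n -> F) t :
  (\sum_(j < n) G j : F) t = \sum_(j < n) G j t.
Proof. by elim/big_rec2 : _ => // j x f _ <-. Qed.

(** The last hypothesis makes composition with [phi] well defined on classes and norm nonincreasing;
    applying it twice gives an isometry, since [phi] is an involution. *)
Lemma signed_involution_isometry (sigma : T -> R) (phi : T -> T) :
  measurable_fun setT sigma -> measurable_fun setT phi ->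
  (forall t, `|sigma t| = 1) -> {ae mu, forall t, phi (phi t) = t} ->
  (forall A : set T, {ae mu, forall t, A t} -> {ae mu, forall t, A (phi t)}) ->
  exists tau : F -> F, seminorm_isometry q tau /\
    forall f t, tau f t = sigma t * f (phi t).
Proof.
move=> msigma mphi sigma1 phiK phi_ae.
have bounded (f : F) : {ae mu, forall t, `|sigma t * f (phi t)| <= q f}.
  have /(Linfty_seminormP f (q f)) /phi_ae := lexx (q f).
  by apply: filterS => t; rewrite normrM sigma1 mul1r.
have tauF (f : F) : (fun t => sigma t * f (phi t)) \in Lfun mu +oo%E.
  apply: (ae_bounded_Lfun _ (bounded f)); apply: measurable_funM => //.
  exact: measurableT_comp.
pose tau f : F := Lfun_Sub (leey 1) (tauF f).
exists tau; split=> //; split=> [a f g|f|g].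
- apply: val_inj; apply/funext => t.
  rewrite -[LHS]/(sigma t * (a * f (phi t) + g (phi t))).
  rewrite -[RHS]/(a * (sigma t * f (phi t)) + sigma t * g (phi t)).
  by rewrite mulrDr mulrCA.
- apply/eqP; rewrite eq_le; apply/andP; split; apply/Linfty_seminormP.
    exact: bounded.
  have /(Linfty_seminormP (tau f) (q (tau f))) /phi_ae := lexx (q (tau f)).
  apply: filterS2 phiK => t phiK.
  by rewrite -[tau f _]/(sigma (phi t) * f (phi (phi t))) normrM sigma1 mul1r phiK.
(* The inverse composes with [phi] as well, with sign [sigma \o phi]; the two signs multiply to
   [sigma t ^+ 2 = 1]. *)
- have gF : (fun t => sigma (phi t) * g (phi t)) \in Lfun mu +oo%E.
    apply: (@ae_bounded_Lfun _ (q g)).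
      by apply: measurable_funM; exact: measurableT_comp.
    have /(Linfty_seminormP g (q g)) /phi_ae := lexx (q g).
    by apply: filterS => t; rewrite normrM sigma1 mul1r.
  exists (Lfun_Sub (leey 1) gF); apply/(seminorm_eq0 q); rewrite inE.
  apply: filterS phiK => t phiK.
  rewrite -[LHS]/(sigma t * (sigma (phi (phi t)) * g (phi (phi t))) - g t) phiK.
  by rewrite mulrA -expr2 -real_normK ?num_real// sigma1 expr1n mul1r subrr.
Qed.

End Linfty_isometry.

(** * Nonsingular involutions exchanging two sets *)

Section swaps.
Context {R : realType}.
Local Notation T := (measurableTypeR R).
Variable mu : {measure set T -> \bar R}.
Hypotheses (mu1 : forall t : R, mu [set t] = 0%E) (mu_fin : (mu setT < +oo)%E).

Let mu_fin_num B : measurable B -> mu B \is a fin_num.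
Proof.
move=> mB; rewrite ge0_fin_numE// (le_lt_trans _ mu_fin)//.
by apply: le_measure; rewrite ?inE.
Qed.

Lemma uniform_density (B : set T) : measurable B -> (0 < mu B)%E ->
  exists h : T -> R,
  [/\ forall t, 0 <= h t, measurable_fun setT h, (\int[mu]_t (h t)%:E = 1)%E,
      forall t, B t -> h t != 0 &
      forall C, measurable C ->
        (\int[mu]_t ((\1_C t)%:E * (h t)%:E) = ((fine (mu B))^-1)%:E * mu (C `&` B))%E].
Proof.
move=> mB B0.
have b0 : 0 < fine (mu B) by rewrite fine_gt0// B0 -ge0_fin_numE// mu_fin_num.
pose h t : R := (fine (mu B))^-1 * \1_B t.
have hC C : measurable C ->
    (\int[mu]_t ((\1_C t)%:E * (h t)%:E) = ((fine (mu B))^-1)%:E * mu (C `&` B))%E.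
  move=> mC.
  transitivity (\int[mu]_t (((fine (mu B))^-1)%:E * (\1_(C `&` B) t)%:E))%E.
    by apply: eq_integral => t _; rewrite /h indicI -!EFinM mulrCA.
  rewrite ge0_integralZl//; last first.
    by apply/measurable_EFinP; exact/measurable_indic/measurableI.
  by rewrite integral_indic ?setIT//; exact: measurableI.
exists h; split=> // [t|||t Bt].
- by rewrite mulr_ge0// invr_ge0 ltW.
- by apply: measurable_funM => //; exact: measurable_indic.
- have <- : (((fine (mu B))^-1)%:E * mu B = 1)%E.
    by rewrite -[X in (_ * X)%E](fineK (mu_fin_num mB)) -EFinM mulVf ?gt_eqF.
  have := hC setT measurableT; rewrite setTI => <-.
  by apply: eq_integral => t _; rewrite indicT mul1e.
- by rewrite /h indicE mem_set// mulr1 invr_eq0 gt_eqF.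
Qed.

(** The uniform laws on [B0] and [B1] are transported to each other. The last two clauses serve
    twice: with [C] a complement they locate images, and with [C] a null set they give
    nonsingularity. *)
Lemma set_transport (B0 B1 : set T) : measurable B0 -> measurable B1 ->
  (0 < mu B0)%E -> (0 < mu B1)%E ->
  exists th th' : T -> T,
  [/\ measurable_fun setT th /\ measurable_fun setT th',
      {ae mu, forall t, B0 t -> th' (th t) = t},
      {ae mu, forall t, B1 t -> th (th' t) = t},
      forall C, measurable C -> mu (C `&` B1) = 0%E ->
        {ae mu, forall t, B0 t -> ~ C (th t)} &
      forall C, measurable C -> mu (C `&` B0) = 0%E ->
        {ae mu, forall t, B1 t -> ~ C (th' t)}].
Proof.
move=> mB0 mB1 B00 B10.
have [h0 [h0_ge0 mh0 h0_1 h0B h0C]] := uniform_density mB0 B00.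
have [h1 [h1_ge0 mh1 h1_1 h1B h1C]] := uniform_density mB1 B10.
have [th [th' [[mth mth'] thE th'E thK th'K]]] :=
  density_transport mu1 h0_ge0 h1_ge0 mh0 mh1 h0_1 h1_1.
have avoid (B B' : set T) (h h' : T -> R) (f : T -> T) (C : set T) :
    measurable C -> measurable_fun setT f -> measurable_fun setT h ->
    (forall t, 0 <= h t) -> (forall t, B t -> h t != 0) ->
    (\int[mu]_t ((\1_C (f t))%:E * (h t)%:E) =
      \int[mu]_t ((\1_C t)%:E * (h' t)%:E))%E ->
    (\int[mu]_t ((\1_C t)%:E * (h' t)%:E) = 0)%E ->
    {ae mu, forall t, B t -> ~ C (f t)}.
  move=> mC mf mh h_ge0 hB fE int0.
  have mg : measurable_fun setT (fun t => (\1_C (f t))%:E * (h t)%:E)%E.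
    apply: emeasurable_funM; apply/measurable_EFinP => //.
    by apply: measurableT_comp => //; exact: measurable_indic.
  have : (\int[mu]_t `|(\1_C (f t))%:E * (h t)%:E| = 0)%E.
    rewrite -[RHS]int0 -fE; apply: eq_integral => t _.
    by rewrite gee0_abs// mule_ge0// lee_fin.
  move/(ae_eq_integral_abs mu measurableT mg).
  apply: filterS => t /(_ I) /eqP /=; rewrite -EFinM eqe mulf_eq0 => + Bt Ct.
  by rewrite (negbTE (hB t Bt)) orbF indicE mem_set// oner_eq0.
have indE C : (forall t, 0 <= (\1_C t : R)%:E)%E by move=> t; rewrite lee_fin.
have mind C : measurable C -> measurable_fun setT (fun t : T => (\1_C t : R)%:E).
  by move=> mC; apply/measurable_EFinP; exact: measurable_indic.
exists th, th'; split=> // [||C mC C0|C mC C0].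
- by apply: filterS thK => t + Bt; apply; exact: h0B.
- by apply: filterS th'K => t + Bt; apply; exact: h1B.
- apply: (avoid B0 B1 h0 h1) => //; first by apply: thE => //; exact: mind.
  by rewrite h1C// C0 mule0.
- apply: (avoid B1 B0 h1 h0) => //; first by apply: th'E => //; exact: mind.
  by rewrite h0C// C0 mule0.
Qed.

Lemma measurable_fun_ifset (B : set T) (f g : T -> T) : measurable B ->
  measurable_fun setT f -> measurable_fun setT g ->
  measurable_fun setT (fun t => if t \in B then f t else g t).
Proof.
move=> mB mf mg; apply: measurable_fun_ifT => //.
apply: (measurable_fun_bool true); rewrite setTI.
by rewrite (_ : _ @^-1` _ = B)//; apply/seteqP; split=> t; [exact: set_mem|exact: mem_set].
Qed.

(** [phi] is [th] on [B0], [th'] on [B1] and the identity elsewhere. *)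
Lemma measurable_set_swap (B0 B1 : set T) : measurable B0 -> measurable B1 ->
  (0 < mu B0)%E -> (0 < mu B1)%E -> (forall t, B0 t -> ~ B1 t) ->
  exists phi : T -> T,
  [/\ measurable_fun setT phi, {ae mu, forall t, phi (phi t) = t},
      forall A : set T, {ae mu, forall t, A t} -> {ae mu, forall t, A (phi t)} &
      {ae mu, forall t, B0 (phi t) -> B1 t}].
Proof.
move=> mB0 mB1 B00 B10 B01.
have [th [th' [[mth mth'] thK th'K thC th'C]]] := set_transport mB0 mB1 B00 B10.
pose phi t := if t \in B0 then th t else if t \in B1 then th' t else t.
have phi0 t : B0 t -> phi t = th t by move=> Bt; rewrite /phi mem_set.
have phi1 t : B1 t -> phi t = th' t.
  move=> Bt; rewrite /phi memNset ?mem_set// => Bt'; exact: B01 Bt' Bt.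
have phi2 t : ~ B0 t -> ~ B1 t -> phi t = t by move=> h0 h1; rewrite /phi !memNset.
have th1 : {ae mu, forall t, B0 t -> B1 (th t)}.
  have := thC _ (measurableC mB1); rewrite setICl measure0 => /(_ erefl).
  by apply: filterS => t + Bt => /(_ Bt) /contrapT.
have th'0 : {ae mu, forall t, B1 t -> B0 (th' t)}.
  have := th'C _ (measurableC mB0); rewrite setICl measure0 => /(_ erefl).
  by apply: filterS => t + Bt => /(_ Bt) /contrapT.
exists phi; split.
- by do 2 apply: measurable_fun_ifset => //; exact: measurable_id.
- apply: filterS2 (filterI thK th'K) (filterI th1 th'0) => t [thKt th'Kt] [th1t th'0t].
  have [Bt|nBt] := pselect (B0 t).
    by rewrite (phi0 t Bt) (phi1 _ (th1t Bt)) thKt.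
  have [Bt|nB1t] := pselect (B1 t).
    by rewrite (phi1 t Bt) (phi0 _ (th'0t Bt)) th'Kt.
  by rewrite !phi2.
- move=> A aeA; have [N [mN N0 AN]] := aeA.
  have NB B : measurable B -> mu (N `&` B) = 0%E.
    move=> mB; apply: (@subset_measure0 _ _ _ mu _ N) => //; exact: measurableI.
  apply: filterS3 aeA (thC _ mN (NB _ mB1)) (th'C _ mN (NB _ mB0)) => t At h0 h1.
  have [Bt|nBt] := pselect (B0 t).
    by rewrite (phi0 t Bt); apply: contrapT => /AN; exact: (h0 Bt).
  have [Bt|nB1t] := pselect (B1 t).
    by rewrite (phi1 t Bt); apply: contrapT => /AN; exact: (h1 Bt).
  by rewrite phi2.
- apply: filterS th1 => t th1t B0phi.
  have [Bt|nBt] := pselect (B0 t).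
    by case: (B01 _ B0phi); rewrite (phi0 t Bt); exact: th1t.
  by apply: contrapT => nB1t; rewrite (phi2 t nBt nB1t) in B0phi.
Qed.

(** The distribution function of the uniform law on [A] pulls [n] equal subintervals of the unit
    interval back to disjoint pieces of positive measure. Open intervals do, as the pieces need not
    cover [A]. *)
Lemma atomless_partition (A : set T) (n : nat) : measurable A -> (0 < mu A)%E ->
  exists B : nat -> set T,
  [/\ forall j, measurable (B j), forall j, (j < n)%N -> (0 < mu (B j))%E,
      forall i j t, B i t -> B j t -> i = j & forall j, B j `<=` A].
Proof.
move=> mA A0.
have [h [h_ge0 mh h_1 hA hC]] := uniform_density mA A0.
have [P [P0 Pint _]] := atomless_density mu1 h_ge0 mh h_1.
have [F [Q [mF mQ QE FQ]]] := quantile_transform P0.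
have mpre (f : T -> T) C : measurable_fun setT f -> measurable C -> measurable (f @^-1` C).
  by move=> mf mC; rewrite -[_ @^-1` _]setTI; exact: mf.
pose I j : set T := `]j%:R / n%:R, j.+1%:R / n%:R[%classic.
have mI j : measurable (I j) by exact: measurable_itv.
exists (fun j => A `&` F @^-1` (I j)); split.
- by move=> j; apply: measurableI => //; exact: (mpre _ _ mF (mI j)).
- move=> j jn; have n0 : (0 : R) < n%:R by rewrite ltr0n (leq_trans _ jn).
  rewrite lt0e measure_ge0 andbT; apply/eqP => AI0.
  have mFI := mpre _ _ mF (mI j).
  have : P (F @^-1` (I j)) = 0%E.
    rewrite -(setIT (F @^-1` _)) -integral_indic//.
    rewrite Pint; last 2 first.
    - by move=> t; rewrite lee_fin.
    - by apply/measurable_EFinP; exact: measurable_indic.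
    by rewrite hC// setIC AI0 mule0.
  rewrite -QE//.
  have jn1 : j.+1%:R / n%:R <= 1 :> R by rewrite ler_pdivrMr// mul1r ler_nat.
  have j0 : 0 <= j%:R / n%:R :> R by rewrite divr_ge0.
  have jj : j%:R / n%:R < j.+1%:R / n%:R :> R by rewrite ltr_pM2r ?invr_gt0// ltr_nat.
  apply/eqP; rewrite gt_eqF//.
  apply: (@lt_le_trans _ _ (unit_interval_measure R (I j))).
    rewrite unit_interval_measureE setIidl.
      by rewrite lebesgue_measure_itv/= lte_fin jj -EFinD lte_fin subr_gt0.
    move=> t /=; rewrite !in_itv/= => /andP[jt tj].
    by rewrite (le_trans j0 (ltW jt)) (le_trans (ltW tj)).
  apply: le_measure; rewrite ?inE//; first exact: mpre _ _ mQ mFI.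
  move=> t /= It; rewrite /= FQ//.
  move: It; rewrite /I/= in_itv/= => /andP[jt tj].
  by rewrite (le_lt_trans j0 jt) (lt_le_trans tj).
- move=> i j t [_ +] [_ +]; rewrite /I/= !in_itv/= => /andP[it ti] /andP[jt tj].
  (* For [n = 0], division by zero makes every interval [I j] empty. *)
  have [n0|n0] := posnP n.
    by move: it ti; rewrite n0 invr0 !mulr0 => it /(lt_trans it); rewrite ltxx.
  have n0' : (0 : R) < n%:R by rewrite ltr0n.
  have := lt_trans it tj; have := lt_trans jt ti.
  rewrite !ltr_pM2r ?invr_gt0// !ltr_nat !ltnS => h1 h2.
  by apply/eqP; rewrite eqn_leq h1 h2.
- by move=> j t [].
Qed.

End swaps.

(** * Averages of signed involutions *)

Section Linfty_orbit_average.
Context {R : realType}.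
Local Notation T := (measurableTypeR R).

(** The sum is the ceiling of [m]. *)
Lemma threshold_sum (n : nat) (m : R) : 0 <= m <= n%:R ->
  m <= \sum_(j < n) (if j%:R < m then 1 else 0 : R) <= m + 1.
Proof.
elim: n => [|n IH]; first by rewrite big_ord0; lra.
move=> /andP[m0 mn1]; rewrite big_ord_recr/=.
case: ltP => nm; last by rewrite addr0 IH// m0.
rewrite (eq_bigr (fun=> 1)) => [|j _].
  by rewrite sumr_const card_ord; move: mn1; rewrite -natr1; lra.
by rewrite ifT// (le_lt_trans _ nm)// ler_nat ltnW.
Qed.

(** For [m = n (1 + y) / 2], the signs add up to twice the ceiling of [m] minus [n], while
    [n y = 2 m - n]. *)
Lemma signs_average (n : nat) (y : R) : `|y| <= 1 ->
  `|\sum_(j < n) (if j%:R < n%:R * ((1 + y) / 2) then 1 else -1) - n%:R * y| <= 2.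
Proof.
move=> y1; set m := n%:R * _.
have m0n : 0 <= m <= n%:R.
  have : 0 <= (1 + y) / 2 <= 1 by move: y1; rewrite ler_norml; lra.
  by move=> /andP[h1 h2]; rewrite /m mulr_ge0//= ler_piMr.
have := threshold_sum m0n.
have -> : \sum_(j < n) (if j%:R < m then 1 else -1) =
    2 * (\sum_(j < n) (if j%:R < m then 1 else 0 : R)) - n%:R.
  have -> : n%:R = \sum_(j < n) (1 : R) by rewrite sumr_const card_ord.
  rewrite mulr_sumr -sumrB.
  by apply: eq_bigr => j _; case: ifP => _; lra.
have -> : n%:R * y = 2 * m - n%:R by rewrite /m; lra.
by rewrite ler_norml; lra.
Qed.

Lemma sum_bad_le1 (n : nat) (D : 'I_n -> set T) t :
  (forall i j, D i t -> D j t -> i = j) ->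
  \sum_(j < n) (\1_(D j) t : R) <= 1.
Proof.
move=> Dij; have [[j Djt]|h] := pselect (exists j, D j t).
  rewrite (bigD1 j)//= big1 ?addr0 ?indicE; first by rewrite mem_set.
  move=> i ij; rewrite indicE memNset// => Dit.
  by move: ij; rewrite (Dij _ _ Dit Djt) eqxx.
rewrite big1 ?ler01// => j _; rewrite indicE memNset// => Djt.
by apply: h; exists j.
Qed.

Variable mu : {measure set T -> \bar R}.
Hypotheses (mu1 : forall t : R, mu [set t] = 0%E) (mu_fin : (mu setT < +oo)%E).
Hypothesis mu_gt0 : (0 < mu setT)%E.
Local Notation F := (LfunType mu (leey 1)).
Local Notation q := (Lfun_seminorm mu (leey 1)).

(** [Z] contains the complement of [A], and also [B 0], which gives it positive measure. The first
    involution is the identity, the [j]-th swaps [Z] with [B j]; so [phi j t] lies in [Z] only for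
    [t] in [Z] or in [B j] respectively, and these sets are disjoint. *)
Lemma exists_disjoint_swaps (A : set T) (n : nat) : measurable A -> (0 < mu A)%E ->
  exists (phi : 'I_n.+1 -> T -> T) (D : 'I_n.+1 -> set T),
  [/\ forall j, measurable_fun setT (phi j),
      forall j, {ae mu, forall t, phi j (phi j t) = t},
      forall j (B : set T), {ae mu, forall t, B t} -> {ae mu, forall t, B (phi j t)},
      forall i j t, D i t -> D j t -> i = j &
      forall j, {ae mu, forall t, ~ A (phi j t) -> D j t}].
Proof.
move=> mA A0.
have [B [mB B0 Bij BA]] := atomless_partition mu1 mu_fin n.+1 mA A0.
pose Z : set T := ~` \bigcup_(j in [set j | (0 < j < n.+1)%N]) B j.
have mZ : measurable Z by apply: measurableC; exact: bigcup_measurable.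
have AZ t : ~ A t -> Z t by move=> nAt [j _ /BA].
have B0Z : B 0%N `<=` Z by move=> t B0t [j /= j0 /(Bij _ _ _ B0t) j0']; rewrite -j0' in j0.
have Z0 : (0 < mu Z)%E.
  by apply: lt_le_trans (B0 0%N _) _ => //; apply: le_measure; rewrite ?inE.
have ex (j : 'I_n.+1) : exists phiD : (T -> T) * set T,
  [/\ measurable_fun setT phiD.1, {ae mu, forall t, phiD.1 (phiD.1 t) = t},
      forall B : set T, {ae mu, forall t, B t} -> {ae mu, forall t, B (phiD.1 t)},
      phiD.2 = (if j == ord0 then Z else B j) &
      {ae mu, forall t, Z (phiD.1 t) -> phiD.2 t}].
  have [_|j0] := eqVneq j ord0.
    exists (id, Z); split=> //=; [exact: nearW|exact: nearW].
  have j0' : (0 < j)%N by rewrite lt0n.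
  have ZB t : Z t -> ~ B j t by move=> Zt Bt; apply: Zt; exists j => //=; rewrite j0' ltn_ord.
  have [phi [h1 h2 h3 h4]] := measurable_set_swap mu1 mu_fin mZ (mB j) Z0 (B0 _ (ltn_ord j)) ZB.
  by exists (phi, B j).
have [phiD PD] := choice ex.
exists (fun j => (phiD j).1), (fun j => (phiD j).2); split.
- by move=> j; have [] := PD j.
- by move=> j; have [] := PD j.
- by move=> j; have [] := PD j.
- move=> i j t; have [_ _ _ -> _] := PD i; have [_ _ _ -> _] := PD j.
  have ZB (k : 'I_n.+1) : k != ord0 -> Z t -> B k t -> False.
    by move=> k0 Zt Bt; apply: Zt; exists k => //=; rewrite lt0n k0 ltn_ord.
  case: eqVneq => [->|i0]; case: eqVneq => [->|j0] //.
  + by move=> Zt /(ZB _ j0 Zt).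
  + by move=> Bt Zt; case: (ZB _ i0 Zt Bt).
  + by move=> h1 h2; apply: val_inj; exact: Bij h1 h2.
- move=> j; have [_ _ _ _] := PD j.
  by apply: filterS => t h /AZ.
Qed.

(** Before division by [n + 1] the error is at most 4: 2 from rounding [g t] to signs, and 2 from
    replacing each [|f (phi j t)|] by 1. *)
Lemma Linfty_orbit_average n :
  orbit_average_dense (real_Lspace mu (leey 1)) n (4 / n.+1%:R).
Proof.
apply: seminorm_quot_orbit_average => f g f1 g1.
have n0 : (0 : R) < n.+1%:R by rewrite ltr0n.
pose e : R := n.+1%:R^-1.
have e01 : 0 < e <= 1 by rewrite /e invr_gt0 n0 invf_le1// ler1n.
pose A : set T := [set t | 1 - e < `|f t|].
have mf : measurable_fun setT f by exact: measurable_funP.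
have mg : measurable_fun setT g by exact: measurable_funP.
have mA : measurable A.
  rewrite -[A]setTI; apply: (measurable_fun_ltr _ _ measurableT (Y := [set true])) => //.
  exact: measurableT_comp.
(* Otherwise [|f| <= 1 - e] almost everywhere, against [q f = 1]. *)
have A0 : (0 < mu A)%E.
  rewrite lt0e measure_ge0 andbT; apply/eqP => A0.
  have : q f <= 1 - e.
    apply/(Linfty_seminormP mu_gt0); exists A; split=> // t /= /negP.
    by rewrite -ltNge.
  by rewrite f1; lra.
have [phi [D [mphi phiK phi_ae Dij AD]]] := exists_disjoint_swaps n mA A0.
pose s (j : 'I_n.+1) t : R := if j%:R < n.+1%:R * ((1 + g t) / 2) then 1 else -1.
(* The second factor cancels the sign of [f (phi j t)], so that [tau j f] has the prescribed sign
   [s j]. *)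
pose sigma j t : R := s j t * (if f (phi j t) < 0 then -1 else 1).
have ms j : measurable_fun setT (s j).
  apply: measurable_fun_ifT => //; apply: measurable_fun_ltr => //.
  by apply: measurable_funM => //; apply: measurable_funM => //; exact: measurable_funD.
have msigma j : measurable_fun setT (sigma j).
  apply: measurable_funM => //; apply: measurable_fun_ifT => //.
  by apply: measurable_fun_ltr => //; exact: measurableT_comp.
have s1 j t : `|s j t| = 1 by rewrite /s; case: ifP; rewrite ?normrN normr1.
have sigma1 j t : `|sigma j t| = 1.
  by rewrite normrM s1 mul1r; case: ifP; rewrite ?normrN normr1.
have [tau tauP] := choice (fun j =>
  signed_involution_isometry mu_gt0 (msigma j) (mphi j) (sigma1 j) (phiK j) (phi_ae j)).
exists tau; split=> [j|]; first by have [] := tauP j.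
have tauE j t : tau j f t = s j t * `|f (phi j t)|.
  have [_ ->] := tauP j; rewrite /sigma -mulrA; congr (_ * _).
  by case: ltP => f0; [rewrite mulN1r ltr0_norm|rewrite mul1r ger0_norm].
apply/(Linfty_seminormP mu_gt0).
have fle1 : {ae mu, forall t, `|f t| <= 1} by apply/(Linfty_seminormP mu_gt0); rewrite f1.
have gle1 : {ae mu, forall t, `|g t| <= 1} by apply/(Linfty_seminormP mu_gt0); rewrite g1.
have fphi : {ae mu, forall t (j : 'I_n.+1), `|f (phi j t)| <= 1}.
  by apply: filter_forall => j; exact: (phi_ae j _ fle1).
have Dphi : {ae mu, forall t (j : 'I_n.+1), ~ A (phi j t) -> D j t}.
  by apply: filter_forall.
apply: filterS3 gle1 fphi Dphi => t gt1 fphit Dt.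
rewrite -[_ t]/(g t - n.+1%:R^-1 * ((\sum_(j < n.+1) tau j f : F) t)) Lfun_sumE.
have -> : g t - n.+1%:R^-1 * (\sum_(j < n.+1) tau j f t) =
    n.+1%:R^-1 * (n.+1%:R * g t - \sum_(j < n.+1) tau j f t).
  by rewrite mulrBr mulrA mulVf ?gt_eqF// mul1r.
rewrite normrM gtr0_norm ?invr_gt0// mulrC ler_pM2r ?invr_gt0//.
have := signs_average n.+1 gt1; rewrite -/(\sum_(j < n.+1) s j t).
set S := \sum_(j < n.+1) s j t => Sg.
(* The [n + 1] errors [e] add up to 1, and at most one index is bad at [t], with an error at most
   1. *)
have St : `|S - \sum_(j < n.+1) tau j f t| <= 2.
  rewrite /S -sumrB (le_trans (ler_norm_sum _ _ _))//.
  apply: (@le_trans _ _ (\sum_(j < n.+1) (e + \1_(D j) t))).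
    apply: ler_sum => j _; rewrite tauE -[X in X - _]mulr1 -mulrBr normrM s1 mul1r.
    rewrite ger0_norm ?subr_ge0//.
    have [At|nAt] := pselect (A (phi j t)).
      rewrite (@le_trans _ _ e)//; last by rewrite lerDl.
      by move: At; rewrite /A/= => /ltW; rewrite lerBlDl -lerBlDr.
    rewrite indicE mem_set; last exact: Dt.
    have := normr_ge0 (f (phi j t)); case/andP: e01 => /ltW e0 _ /= f0.
    by rewrite mulr1n lerBlDr addrAC lerDr addr_ge0.
  rewrite big_split/= sumr_const card_ord -[e *+ _]mulr_natr mulVf ?gt_eqF//.
  have : \sum_(j < n.+1) (\1_(D j) t : R) <= 1 by apply: sum_bad_le1 => i j; exact: Dij.
  lra.
rewrite (_ : _ - _ = (S - \sum_(j < n.+1) tau j f t) - (S - n.+1%:R * g t)).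
  by rewrite (le_trans (ler_normB _ _))// (le_trans (lerD St Sg))//; lra.
by rewrite opprB [RHS]addrC addrA subrK.
Qed.

End Linfty_orbit_average.

(** * Limits along a nonprincipal ultrafilter, and conclusion *)

(** An ultrafilter containing a singleton is principal; so [U] contains the complements of
    singletons, and by induction every tail. *)
Lemma nonprincipal_eventually (U : set_system nat) : UltraFilter U ->
  nonprincipal U -> forall A : set nat, (\forall n \near \oo, A n) -> U A.
Proof.
move=> UU Unp A [N _ NA]; suff UN : U [set n | (N <= n)%N] by exact: (@filterS _ U _ _ A NA UN).
have notk k : U (~` [set k]).
  have [Uk|//] := in_ultra_setVsetC [set k] UU.
  exfalso; apply: (Unp k); have [_] := principal_filter_ultra k; apply => B.
  by move=> /principal_filterP Bk; apply: filterS Uk => _ ->.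
elim: N {NA} => [|N IH]; first exact: filterE.
apply: filterS2 IH (notk N) => n /= Nn nN.
by rewrite ltn_neqAle Nn andbT; apply/eqP => /esym.
Qed.

Theorem theorem3p7 (R : realType) (X : completeNormedModType R)
    (U : set_system nat) (UU : UltraFilter U) (Unp : nonprincipal U) :
  (almost_transitive_space X -> transitive_space (ultra_Lspace U X)) /\
  (uniformly_convex_transitive X ->
    uniformly_convex_transitive (ultra_Lspace U X) /\
    uniformly_convex_transitive (ultrapower U X)) /\
  uniformly_convex_transitive (ultrapower U (Linfty01 R)).
Proof.
have lam1 := @unit_interval_measure_set1 R.
have lamT := @unit_interval_measure_setT R.
have lam_fin : (unit_interval_measure R setT < +oo)%E by rewrite lamT ltry.
have lam_gt0 : (0 < unit_interval_measure R setT)%E by rewrite lamT.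
have cst_near (e d : R) : 0 < d -> \forall i \near U, e <= e + d.
  by move=> d0; apply: nearW => i; rewrite lerDl ltW.
split; [|split].
(* Almost transitivity allows any positive error with a single isometry. Coordinate [i] gets the
   error [1 / (i + 1)], which tends to 0 along [U], so the error in the ultraproduct is exactly
   0. *)
- move=> atX; apply: orbit_average_transitive.
  have cvg0 : (i.+1%:R^-1 : R) @[i --> U] --> (0 : R).
    by move=> A /(@cvg_harmonic R) /(nonprincipal_eventually UU Unp).
  apply: (@ultraproduct_orbit_average _ _ _ _ _ _ (fun i => i.+1%:R^-1)) => //.
    move=> d d0; rewrite add0r.
    by move/cvgrPdist_le : cvg0 => /(_ _ d0); apply: filterS => i; rewrite sub0r normrN ger0_norm.
  move=> i; have e0 : (0 : R) < i.+1%:R^-1 / 2 by rewrite divr_gt0 ?invr_gt0.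
  rewrite [X in orbit_average_dense _ _ X](splitr _).
  apply: (Bochner_orbit_average lam1 lam_fin (p1 := exponent_ge1 R i) (ltW e0) e0).
  exact: almost_transitive_orbit_average.
(* The number [n] given by [X] serves in all coordinates, since it does not depend on the
   exponent. *)
- move=> uX; split; apply: orbit_average_uct => eps eps0.
    have e0 : 0 < eps / 2 by rewrite divr_gt0.
    have [n Xn] := uct_orbit_average e0 uX; exists n.
    apply: (@ultraproduct_orbit_average _ _ _ _ _ _ (fun=> eps)) => [|d d0|i].
    + exact: ltW.
    + exact: cst_near.
    + rewrite [X in orbit_average_dense _ _ X](splitr _).
      exact: (Bochner_orbit_average lam1 lam_fin (p1 := exponent_ge1 R i) (ltW e0) e0 Xn).
  have [n Xn] := uct_orbit_average eps0 uX; exists n.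
  apply: (@ultraproduct_orbit_average _ _ _ _ _ _ (fun=> eps)) => [|d d0|i] //.
  + exact: ltW.
  + exact: cst_near.
- apply: orbit_average_uct => eps eps0.
  (* Chosen so that the error [4 / (n + 1)] in each coordinate is at most [eps]. *)
  pose n := truncn (4 / eps).
  have n_eps : 4 / n.+1%:R <= eps.
    by rewrite ler_pdivrMr ?ltr0n// mulrC -ler_pdivrMr// ltW// truncnS_gt.
  exists n; apply: (@ultraproduct_orbit_average _ _ _ _ _ _ (fun=> 4 / n.+1%:R)) => [|d d0|i].
  + exact: ltW.
  + by apply: filterS (cst_near eps d d0) => _; exact: le_trans n_eps.
  + exact: Linfty_orbit_average.
Qed.
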